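(* Let $\varphi\in L^\infty$ and let $\lambda\in\mathbb{C}$ with $|\lambda|=1$. The Toeplitz operator $T_\varphi$ on $H^2$ is complex symmetric with the conjugation $C_{1,\lambda}$ if and only if $\varphi(z)=\varphi(\lambda\overline z)$ on $|z|=1$ (almost everywhere).
   Context: $L^2$ and $L^\infty$ are the Lebesgue spaces on the unit circle $\partial\mathbb{D}$, $H^2$ is the Hardy space of the unit disk (viewed as a closed subspace of $L^2$), and $P$ is the orthogonal projection of $L^2$ onto $H^2$. For $\varphi\in L^\infty$, $T_\varphi f=P(\varphi f)$, $f\in H^2$, is the Toeplitz operator. For $|\lambda|=1$, $C_{1,\lambda}:H^2\to H^2$ is the conjugation $C_{1,\lambda}f(z)=\overline{f(\lambda\overline z)}$. A conjugation on a Hilbert space is an antilinear map $C$ with $C^2=I$ and $\langle Cx,Cy\rangle=\langle y,x\rangle$ for all $x,y$. A bounded operator $T$ is complex symmetric with the conjugation $C$ if $T=CT^*C$. *)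

(* Defs.v *)
From HB Require Import structures.
From mathcomp Require Import all_boot all_order all_algebra.
From mathcomp Require Import complex.
From mathcomp Require Import all_classical all_reals all_analysis measurable_realfun.
Import Order.TTheory GRing.Theory Num.Theory numFieldNormedType.Exports.

Set Implicit Arguments.
Unset Strict Implicit.
Unset Printing Implicit Defensive.

Local Open Scope classical_set_scope.
Local Open Scope ring_scope.

Section complex_borel.
Context {R : realType}.

Definition complex_pair (z : R[i]) : R * R := (complex.Re z, complex.Im z).

Definition complex_borel : set (set R[i]) :=
  preimage_set_system [set: R[i]] complex_pair measurable.

Let sigma_algebra_complex_borel : sigma_algebra [set: R[i]] complex_borel.
Proof. exact/sigma_algebra_preimage/sigma_algebra_measurable. Qed.

Let complex_borel0 : complex_borel set0.
Proof. by have [] := sigma_algebra_complex_borel. Qed.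

Let complex_borelC A : complex_borel A -> complex_borel (~` A).
Proof. by have [_ + _ mA] := sigma_algebra_complex_borel; rewrite -setTD; exact. Qed.

Let complex_borel_bigcup (F : (set R[i])^nat) :
  (forall n, complex_borel (F n)) -> complex_borel (\bigcup_n F n).
Proof. by have [_ _] := sigma_algebra_complex_borel; exact. Qed.

HB.instance Definition _ := isPointed.Build R[i] 0.

HB.instance Definition _ := isMeasurable.Build (preimage_display complex_pair)
  R[i] complex_borel0 complex_borelC complex_borel_bigcup.

End complex_borel.

Section circle.
Context {R : realType}.

Definition expi (t : measurableTypeR R) : R[i] := Complex (cos t) (sin t).

Lemma measurable_expi : measurable_fun [set: measurableTypeR R] expi.
Proof.
have mcs : measurable_fun [set: R] (fun t : R => (cos t, sin t)).
  apply: measurable_fun_pair; apply: continuous_measurable_fun.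
  - exact: continuous_cos.
  - exact: continuous_sin.
by move=> _ _ [B mB <-]; rewrite setTI; exact: mcs.
Qed.

HB.instance Definition _ := isMeasurableFun.Build _ _ _ _ expi measurable_expi.

Lemma pi2_gt0 : 0 < pi *+ 2 :> R.
Proof. by rewrite mulrn_wgt0 // pi_gt0. Qed.

(* Normalized arc length on the unit circle, as a measure on R[i] carried by
   the circle.  Functions on the circle are thus functions on R[i] taken up to
   equality almost everywhere for this measure. *)
Definition circle_measure : probability R[i] R :=
  distribution (uniform_prob pi2_gt0) expi.

End circle.

Section hardy.
Context {R : realType}.
Implicit Types (f g h phi : R[i] -> R[i]) (T C : (R[i] -> R[i]) -> R[i] -> R[i]).

Local Notation circle_measure := (@circle_measure R).

Definition cnorm (p : \bar R) f : \bar R :=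
  ('N[circle_measure]_p[(fun z => (Normc.normc (f z))%:E)])%E.

Definition Lcircle (p : \bar R) : set (R[i] -> R[i]) :=
  [set f | measurable_fun setT f /\ (cnorm p f < +oo)%E].

Definition cintegral f : R[i] :=
  Complex (\int[circle_measure]_z complex.Re (f z))
    (\int[circle_measure]_z complex.Im (f z)).

Definition inner f g : R[i] := cintegral (fun z => f z * (g z)^*).

Definition fourier_coef f (n : int) : R[i] := inner f (fun z => z ^ n).

Definition Hardy2 : set (R[i] -> R[i]) :=
  [set f | Lcircle 2%:E f /\ forall n : int, n < 0 -> fourier_coef f n = 0].

(* Operators on Hardy2 are represented by maps on functions.  In proj_Hardy2 and
   adjoint, the characterizing property determines a function only up to equality
   almost everywhere, and xget picks one representative. *)
Definition proj_Hardy2 f : R[i] -> R[i] :=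
  xget (fun=> 0) [set g | Hardy2 g /\ forall h, Hardy2 h -> inner (f \- g) h = 0].

Definition toeplitz phi f : R[i] -> R[i] := proj_Hardy2 (fun z => phi z * f z).

Definition bounded_operator T : Prop :=
  [/\ forall f, Hardy2 f -> Hardy2 (T f),
      forall (a : R[i]) f g, Hardy2 f -> Hardy2 g ->
        T (fun z => a * f z + g z) = (fun z => a * T f z + T g z) %[ae circle_measure]
    & exists M : R, forall f, Hardy2 f -> (cnorm 2%:E (T f) <= M%:E * cnorm 2%:E f)%E].

Definition adjoint T g : R[i] -> R[i] :=
  xget (fun=> 0) [set h | Hardy2 h /\ forall f, Hardy2 f -> inner (T f) g = inner f h].

Definition conjugation C : Prop :=
  [/\ forall f, Hardy2 f -> Hardy2 (C f),
      forall (a : R[i]) f g, Hardy2 f -> Hardy2 g ->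
        C (fun z => a * f z + g z) = (fun z => a^* * C f z + C g z) %[ae circle_measure],
      forall f, Hardy2 f -> C (C f) = f %[ae circle_measure]
    & forall f g, Hardy2 f -> Hardy2 g -> inner (C f) (C g) = inner g f].

Definition complex_symmetric T C : Prop :=
  [/\ bounded_operator T, conjugation C
    & forall f, Hardy2 f -> T f = C (adjoint T (C f)) %[ae circle_measure]].

Definition C1 (lambda : R[i]) f : R[i] -> R[i] :=
  fun z => (f (lambda * z^*))^*.

End hardy.

(* Main.v *)
Require Import Defs.
From mathcomp Require Import all_boot all_order all_algebra.
From mathcomp Require Import complex.
From mathcomp Require Import all_classical all_reals all_analysis measurable_realfun ess_sup_inf.
Import Order.TTheory GRing.Theory Num.Theory numFieldNormedType.Exports.
From mathcomp Require Import ring lra.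
Local Open Scope classical_set_scope.
Local Open Scope ring_scope.

(** For f, g in H^2, the defining property of the projection gives
    <T_phi f, g> = <phi f, g> and shows that T_phi has the adjoint
    g |-> P(conj phi g).  Write sigma z = lambda * conj z, an involution of the
    circle which preserves arc length, so that C f = conj (f o sigma) satisfies
    <C f, C g> = <g, f>.  Moving C across the inner product and changing
    variables by sigma yields

      <C T_phi^* C f, g> = <(phi o sigma) f, g>     (inner_C1_adjoint_C1).

    Hence T_phi is symmetric for C exactly when <phi f, g> = <(phi o sigma) f, g>
    for all f, g in H^2.  Taking f = z^a and g = z^b with a, b >= 0 makes every
    Fourier coefficient of phi - phi o sigma vanish, so that the two symbols
    agree almost everywhere (fourier_uniqueness); the converse is immediate.

    Three facts of analysis support this argument.

    - The projection onto H^2 exists (orthogonal_projection_exists).  A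
      minimizing sequence for the distance is Cauchy by the parallelogram
      identity; when its increments decrease geometrically in L^2 it converges
      almost everywhere (L2_fast_cauchy_cvg), and Fatou's lemma shows that the
      limit is the minimizer.  H^2 is closed because a Fourier coefficient is
      bounded by the L^2 norm.

    - A bounded function whose Fourier coefficients all vanish is null, and arc
      length is invariant under sigma.  Both follow from one density statement
      (bounded_closed_indic): a linear class of bounded functions on the circle
      which is closed under bounded pointwise limits and contains all the powers
      z^n contains all indicator functions.  The real functions m such that
      multiplication by m preserves {u | u z^n is in the class for all n} form an
      algebra which is closed under bounded limits and contains Re z and Im z.
      Iterating the polynomial 3 x^2 - 2 x^3 on a function of this algebra with
      values in [0, 1] separates the values below 1/2 from those above, so the
      algebra contains the indicators of half-planes; the sets whose indicator
      it contains form a sigma-algebra, which is then the Borel one.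

    - The moments of arc length, int z^n = 0 for n <> 0, are obtained from a
      primitive of t |-> 1 + cos (n t + c) on [0, 2 pi]. *)

Set Implicit Arguments.
Unset Strict Implicit.
Unset Printing Implicit Defensive.

Local Notation Re := (@complex.Re _).
Local Notation Im := (@complex.Im _).

(** * Complex-valued measurable functions *)

Section ComplexMeasurable.
Context d (T : measurableType d) (R : realType).
Implicit Types (f g : T -> R[i]) (z w : R[i]).

(** Squared modulus with values in R, whereas `|z| ^+ 2 lives in R[i]. *)
Definition sqnormc z : R := Re z ^+ 2 + Im z ^+ 2.

Lemma ReD z w : Re (z + w) = Re z + Re w. Proof. by case: z; case: w. Qed.
Lemma ImD z w : Im (z + w) = Im z + Im w. Proof. by case: z; case: w. Qed.
Lemma ReN z : Re (- z) = - Re z. Proof. by case: z. Qed.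
Lemma ImN z : Im (- z) = - Im z. Proof. by case: z. Qed.
Lemma ReM z w : Re (z * w) = Re z * Re w - Im z * Im w.
Proof. by case: z; case: w. Qed.
Lemma ImM z w : Im (z * w) = Re z * Im w + Im z * Re w.
Proof. by case: z; case: w. Qed.
Lemma Re_conj z : Re z^* = Re z. Proof. by case: z. Qed.
Lemma Im_conj z : Im z^* = - Im z. Proof. by case: z. Qed.
Lemma Re0 : Re (0 : R[i]) = 0. Proof. by []. Qed.
Lemma Im0 : Im (0 : R[i]) = 0. Proof. by []. Qed.
Lemma Re1 : Re (1 : R[i]) = 1. Proof. by []. Qed.
Lemma Im1 : Im (1 : R[i]) = 0. Proof. by []. Qed.

Definition ReImE := (ReD, ImD, ReN, ImN, ReM, ImM, Re_conj, Im_conj,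
  Re0, Im0, Re1, Im1).

Lemma eqC z w : Re z = Re w -> Im z = Im w -> z = w.
Proof. by case: z => a b; case: w => c e /= -> ->. Qed.

Lemma sqnormc_ge0 z : 0 <= sqnormc z.
Proof. by rewrite addr_ge0// sqr_ge0. Qed.

Lemma sqnormcE z : sqnormc z = Normc.normc z ^+ 2.
Proof. by case: z => a b; rewrite /= sqr_sqrtr ?addr_ge0 ?sqr_ge0. Qed.

Lemma sqnormcM z w : sqnormc (z * w) = sqnormc z * sqnormc w.
Proof. by rewrite /sqnormc !ReImE; ring. Qed.

Lemma sqnormc_conj z : sqnormc z^* = sqnormc z.
Proof. by rewrite /sqnormc !ReImE sqrrN. Qed.

Lemma mul_conjc z : z * z^* = Complex (sqnormc z) 0.
Proof. by apply: eqC; rewrite !ReImE /= /sqnormc; ring. Qed.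

Lemma sqnormc_eq0 z : sqnormc z = 0 -> z = 0.
Proof.
case: z => a b /eqP; rewrite /sqnormc/= paddr_eq0 ?sqr_ge0//.
by rewrite !sqrf_eq0 => /andP[/eqP-> /eqP->].
Qed.

Lemma sqnormc_eq1 z : `|z| = 1 -> sqnormc z = 1.
Proof.
by move=> z1; have := add_Re2_Im2 z; rewrite z1 expr1n => -[].
Qed.

Lemma sqr_Re_le z : Re z ^+ 2 <= sqnormc z.
Proof. by rewrite /sqnormc lerDl sqr_ge0. Qed.

Lemma sqr_Im_le z : Im z ^+ 2 <= sqnormc z.
Proof. by rewrite /sqnormc lerDr sqr_ge0. Qed.

Lemma measurable_Re : measurable_fun setT (@complex.Re R).
Proof.
move=> _ B mB; rewrite setTI; exists (B `*` setT).
  by apply: measurableX.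
by rewrite setTI; apply/seteqP; split => z //= [].
Qed.

Lemma measurable_Im : measurable_fun setT (@complex.Im R).
Proof.
move=> _ B mB; rewrite setTI; exists (setT `*` B).
  by apply: measurableX.
by rewrite setTI; apply/seteqP; split => z //= [].
Qed.

Lemma measurable_complexP f : measurable_fun setT f <->
  measurable_fun setT (fun x => Re (f x)) /\
  measurable_fun setT (fun x => Im (f x)).
Proof.
split=> [mf|[mr mi] _ _ [B mB <-]].
  by split; [exact: (measurableT_comp measurable_Re)|
             exact: (measurableT_comp measurable_Im)].
have mp : measurable_fun setT (fun x => (Re (f x), Im (f x))).
  exact: measurable_fun_pair.
rewrite [X in _ `&` _ @^-1` X]setTI.
exact: mp.
Qed.

Lemma measurable_cstc z : measurable_fun setT (fun _ : T => z).
Proof. exact: measurable_cst. Qed.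

Lemma measurable_addc f g : measurable_fun setT f -> measurable_fun setT g ->
  measurable_fun setT (fun x => f x + g x).
Proof.
move=> /measurable_complexP[? ?] /measurable_complexP[? ?].
apply/measurable_complexP; split.
  by under eq_fun do rewrite ReD; exact: measurable_funD.
by under eq_fun do rewrite ImD; exact: measurable_funD.
Qed.

Lemma measurable_oppc f : measurable_fun setT f ->
  measurable_fun setT (fun x => - f x).
Proof.
move=> /measurable_complexP[? ?]; apply/measurable_complexP; split.
  by under eq_fun do rewrite ReN; exact: measurableT_comp.
by under eq_fun do rewrite ImN; exact: measurableT_comp.
Qed.

Lemma measurable_conjc f : measurable_fun setT f ->
  measurable_fun setT (fun x => (f x)^*).
Proof.
move=> /measurable_complexP[? ?]; apply/measurable_complexP; split.
  by under eq_fun do rewrite Re_conj.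
by under eq_fun do rewrite Im_conj; exact: measurableT_comp.
Qed.

Lemma measurable_mulc f g : measurable_fun setT f -> measurable_fun setT g ->
  measurable_fun setT (fun x => f x * g x).
Proof.
move=> /measurable_complexP[? ?] /measurable_complexP[? ?].
apply/measurable_complexP; split.
  under eq_fun do rewrite ReM.
  by apply: measurable_funB; exact: measurable_funM.
under eq_fun do rewrite ImM.
by apply: measurable_funD; exact: measurable_funM.
Qed.

Lemma measurable_sqnormc f : measurable_fun setT f ->
  measurable_fun setT (fun x => sqnormc (f x)).
Proof.
move=> /measurable_complexP[? ?].
by apply: measurable_funD; exact: measurable_funX.
Qed.

Lemma measurable_invc f : measurable_fun setT f ->
  measurable_fun setT (fun x => (f x)^-1).
Proof.
move=> mf; have /measurable_complexP[mr mi] := mf.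
have mV : measurable_fun setT (fun x => (sqnormc (f x))^-1).
  (* s^-1 is the real power s `^ (-1), including at s = 0, where both are 0 *)
  have -> : (fun x => (sqnormc (f x))^-1) = (fun x => sqnormc (f x) `^ (- 1)).
    apply/funext => x; have := sqnormc_ge0 (f x); rewrite le_eqVlt.
    move=> /predU1P[<-|s0].
      by rewrite invr0 powR0// oppr_eq0 oner_eq0.
    by rewrite powRN powRr1// ltW.
  by apply: (measurableT_comp (measurable_powR _)); exact: measurable_sqnormc.
apply/measurable_complexP; split.
  have -> : (fun x => Re (f x)^-1) = (fun x => Re (f x) * (sqnormc (f x))^-1).
    by apply/funext => x; case: (f x).
  exact: measurable_funM.
have -> : (fun x => Im (f x)^-1) = (fun x => - (Im (f x) * (sqnormc (f x))^-1)).
  by apply/funext => x; case: (f x).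
by apply: measurableT_comp => //; exact: measurable_funM.
Qed.

Lemma measurable_exprzc f (n : int) : measurable_fun setT f ->
  measurable_fun setT (fun x => f x ^ n).
Proof.
move=> mf.
have mX k : measurable_fun setT (fun x => f x ^+ k).
  elim: k => [|k IH].
    by under eq_fun do rewrite expr0; exact: measurable_cstc.
  by under eq_fun do rewrite exprS; exact: measurable_mulc.
by case: n => n; [exact: mX|exact: measurable_invc].
Qed.

End ComplexMeasurable.

(** * Integrals of complex functions and the inner product of L^2 *)

Section ComplexIntegral.
Context (R : realType).
Implicit Types (f g h : R[i] -> R[i]) (a : R[i]).
Local Notation mu := (@circle_measure R).

Definition cintegrable f := mu.-integrable setT (fun z => (Re (f z))%:E) /\
  mu.-integrable setT (fun z => (Im (f z))%:E).

Lemma cintegrableZ a f : cintegrable f -> cintegrable (fun z => a * f z).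
Proof.
move=> [fr fi]; split.
  under eq_fun do rewrite ReM EFinB !EFinM.
  by apply: integrableB => //; exact: integrableZl.
under eq_fun do rewrite ImM EFinD !EFinM.
by apply: integrableD => //; exact: integrableZl.
Qed.

Lemma cintegralD f g : cintegrable f -> cintegrable g ->
  cintegral (fun z => f z + g z) = cintegral f + cintegral g.
Proof.
move=> [fr fi] [gr gi]; apply: eqC; rewrite ?ReD ?ImD /=.
  by rewrite -RintegralD//; apply: eq_Rintegral => z _; rewrite ReD.
by rewrite -RintegralD//; apply: eq_Rintegral => z _; rewrite ImD.
Qed.

Lemma cintegralZ a f : cintegrable f ->
  cintegral (fun z => a * f z) = a * cintegral f.
Proof.
move=> [fr fi]; apply: eqC; rewrite ?ReM ?ImM /=.
  rewrite -[Re a * _]RintegralZl// -[Im a * _]RintegralZl// -RintegralB//.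
  - by apply: eq_Rintegral => z _; rewrite ReM.
  - exact: (integrableZl measurableT (Re a) fr).
  - exact: (integrableZl measurableT (Im a) fi).
rewrite -[Re a * _]RintegralZl// -[Im a * _]RintegralZl// -RintegralD//.
- by apply: eq_Rintegral => z _; rewrite ImM.
- exact: (integrableZl measurableT (Re a) fi).
- exact: (integrableZl measurableT (Im a) fr).
Qed.

Lemma cintegral_conj f : cintegrable f ->
  cintegral (fun z => (f z)^*) = (cintegral f)^*.
Proof.
move=> [fr fi]; apply: eqC; rewrite ?Re_conj ?Im_conj /=.
  by apply: eq_Rintegral => z _; rewrite Re_conj.
rewrite -mulN1r -RintegralZl//.
by apply: eq_Rintegral => z _; rewrite Im_conj mulN1r.
Qed.

Lemma ae_eq_cintegral f g : measurable_fun setT f -> measurable_fun setT g ->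
  {ae mu, forall z, f z = g z} -> cintegral f = cintegral g.
Proof.
move=> /measurable_complexP[fr fi] /measurable_complexP[gr gi] fg.
apply: eqC => /=; congr fine; apply: ae_eq_integral => //.
- exact/measurable_EFinP.
- exact/measurable_EFinP.
- by apply: filterS fg => z fgz _; rewrite fgz.
- exact/measurable_EFinP.
- exact/measurable_EFinP.
- by apply: filterS fg => z fgz _; rewrite fgz.
Qed.

Lemma cintegrable_le f (u : R[i] -> R) : measurable_fun setT f ->
  mu.-integrable setT (EFin \o u) ->
  (forall z, `|Re (f z)| <= u z) -> (forall z, `|Im (f z)| <= u z) ->
  cintegrable f.
Proof.
move=> /measurable_complexP[fr fi] iu ru iu'; split.
  apply: le_integrable iu => //; first exact/measurable_EFinP.
  by move=> z _ /=; rewrite lee_fin (le_trans (ru z))// ler_norm.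
apply: le_integrable iu => //; first exact/measurable_EFinP.
by move=> z _ /=; rewrite lee_fin (le_trans (iu' z))// ler_norm.
Qed.

End ComplexIntegral.

Section SquareIntegrable.
Context (R : realType).
Implicit Types (f g h : R[i] -> R[i]) (a : R[i]).
Local Notation mu := (@circle_measure R).
Local Notation L2 := (@Lcircle R 2%:E).

Lemma cnorm2E f :
  (cnorm 2%:E f `^ 2 = \int[mu]_z (sqnormc (f z))%:E)%E.
Proof.
rewrite /cnorm poweR_Lnorm ?pnatr_eq0//; apply: eq_integral => z _ /=.
by rewrite powR_mulrn// real_normK ?num_real// -sqnormcE.
Qed.

Lemma L2P f : L2 f <-> measurable_fun setT f /\
  mu.-integrable setT (fun z => (sqnormc (f z))%:E).
Proof.
split=> -[mf fn]; split=> //.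
  apply/integrableP; split; first exact/measurable_EFinP/measurable_sqnormc.
  under eq_integral do rewrite /= ger0_norm ?sqnormc_ge0//.
  by rewrite -cnorm2E poweR_lty.
have /integrableP[_] := fn.
under eq_integral do rewrite /= ger0_norm ?sqnormc_ge0//.
by rewrite -cnorm2E; apply: lty_poweRy; rewrite pnatr_eq0.
Qed.

Lemma L2_measurable f : L2 f -> measurable_fun setT f.
Proof. by case. Qed.

Lemma L2_integrable f : L2 f -> mu.-integrable setT (fun z => (sqnormc (f z))%:E).
Proof. by move/L2P => []. Qed.

Lemma L2_le f (u : R[i] -> R) : measurable_fun setT f ->
  mu.-integrable setT (EFin \o u) ->
  {ae mu, forall z, sqnormc (f z) <= u z} -> L2 f.
Proof.
move=> mf /integrableP[mu' iu] fu; apply/L2P; split=> //; apply/integrableP.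
split; first exact/measurable_EFinP/measurable_sqnormc.
apply: le_lt_trans iu; apply: ae_ge0_le_integral => //.
- by apply/measurable_EFinP/measurableT_comp => //; exact/measurable_sqnormc.
- by apply: measurableT_comp.
apply: filterS fu => z + _ /=; rewrite lee_fin ger0_norm ?sqnormc_ge0//.
by move=> /le_trans; apply; exact: ler_norm.
Qed.

Lemma L2D f g : L2 f -> L2 g -> L2 (fun z => f z + g z).
Proof.
move=> /L2P[mf fi] /L2P[mg gi].
apply: (@L2_le _ (fun z => 2 * sqnormc (f z) + 2 * sqnormc (g z))).
- exact: measurable_addc.
- have -> : EFin \o (fun z => 2 * sqnormc (f z) + 2 * sqnormc (g z)) =
    ((fun z => 2%:E * (sqnormc (f z))%:E) \+ (fun z => 2%:E * (sqnormc (g z))%:E))%E.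
    by apply/funext => z /=; rewrite EFinD !EFinM.
  by apply: integrableD => //; exact: integrableZl.
apply: aeW => z; rewrite /sqnormc !ReImE.
by have := sqr_ge0 (Re (f z) - Re (g z));
  have := sqr_ge0 (Im (f z) - Im (g z)); lra.
Qed.

Lemma L2_bounded_mul f h (M : R) : measurable_fun setT h ->
  {ae mu, forall z, sqnormc (h z) <= M} -> L2 f -> L2 (fun z => h z * f z).
Proof.
move=> mh hM /L2P[mf fi]; apply: (@L2_le _ (fun z => M * sqnormc (f z))).
- exact: measurable_mulc.
- have -> : EFin \o (fun z => M * sqnormc (f z)) = (fun z => M%:E * (sqnormc (f z))%:E)%E.
    by apply/funext => z /=; rewrite EFinM.
  exact: integrableZl.
by apply: filterS hM => z hM; rewrite sqnormcM ler_wpM2r// sqnormc_ge0.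
Qed.

Lemma L2Z a f : L2 f -> L2 (fun z => a * f z).
Proof.
move=> fL; apply: (@L2_bounded_mul f (fun=> a) (sqnormc a)) => //.
exact: aeW.
Qed.

Lemma L2N f : L2 f -> L2 (fun z => - f z).
Proof.
move=> /(L2Z (-1)); congr (Lcircle _ _); apply/funext => z.
by rewrite mulN1r.
Qed.

Lemma L2B f g : L2 f -> L2 g -> L2 (f \- g).
Proof. by move=> fL gL; apply: L2D => //; exact: L2N. Qed.

Lemma L2_cst a : L2 (fun=> a).
Proof.
apply/L2P; split; first exact: measurable_cst.
exact: finite_measure_integrable_cst.
Qed.

Lemma cintegrable_mul f g : L2 f -> L2 g -> cintegrable (fun z => f z * (g z)^*).
Proof.
move=> /L2P[mf fi] /L2P[mg gi].
apply: (@cintegrable_le _ _ (fun z => sqnormc (f z) + sqnormc (g z))).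
- by apply: measurable_mulc => //; exact: measurable_conjc.
- exact: (integrableD _ fi gi).
- move=> z; rewrite !ReImE /sqnormc ler_norml.
  move: (Re (f z)) (Im (f z)) (Re (g z)) (Im (g z)) => x y s t.
  have := sqr_ge0 (x - s); have := sqr_ge0 (x + s).
  have := sqr_ge0 (y - t); have := sqr_ge0 (y + t).
  have := sqr_ge0 x; have := sqr_ge0 y; have := sqr_ge0 s; have := sqr_ge0 t.
  by move=> *; apply/andP; split; lra.
- move=> z; rewrite !ReImE /sqnormc ler_norml.
  move: (Re (f z)) (Im (f z)) (Re (g z)) (Im (g z)) => x y s t.
  have := sqr_ge0 (x - t); have := sqr_ge0 (x + t).
  have := sqr_ge0 (y - s); have := sqr_ge0 (y + s).
  have := sqr_ge0 x; have := sqr_ge0 y; have := sqr_ge0 s; have := sqr_ge0 t.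
  by move=> *; apply/andP; split; lra.
Qed.

Definition sqnorm f : R := \int[mu]_z sqnormc (f z).

Lemma sqnorm_ge0 f : 0 <= sqnorm f.
Proof. by apply: Rintegral_ge0 => z _; exact: sqnormc_ge0. Qed.

Lemma sqnormEFin f : L2 f -> ((sqnorm f)%:E = \int[mu]_z (sqnormc (f z))%:E)%E.
Proof.
by move=> fL; rewrite fineK//; apply: integrable_fin_num => //; exact: L2_integrable.
Qed.

Lemma inner_self f : inner f f = Complex (sqnorm f) 0.
Proof.
apply: eqC => /=; first by apply: eq_Rintegral => z _; rewrite mul_conjc.
transitivity (\int[mu]_(z in setT) (cst 0 z : R)).
  by apply: eq_Rintegral => z _; rewrite mul_conjc.
by rewrite Rintegral_cst// mul0r.
Qed.

Lemma innerDl f g h : L2 f -> L2 g -> L2 h ->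
  inner (fun z => f z + g z) h = inner f h + inner g h.
Proof.
move=> fL gL hL; rewrite /inner -cintegralD; try exact: cintegrable_mul.
by congr cintegral; apply/funext => z; rewrite mulrDl.
Qed.

Lemma innerZl a f h : L2 f -> L2 h ->
  inner (fun z => a * f z) h = a * inner f h.
Proof.
move=> fL hL; rewrite /inner -cintegralZ; last exact: cintegrable_mul.
by congr cintegral; apply/funext => z; rewrite mulrA.
Qed.

Lemma innerC f g : L2 f -> L2 g -> inner f g = (inner g f)^*.
Proof.
move=> fL gL; rewrite /inner -cintegral_conj; last exact: cintegrable_mul.
by congr cintegral; apply/funext => z; apply: eqC; rewrite !ReImE; ring.
Qed.

Lemma innerBl f g h : L2 f -> L2 g -> L2 h ->
  inner (f \- g) h = inner f h - inner g h.
Proof.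
move=> fL gL hL; rewrite -mulN1r -innerZl// -innerDl//; last exact: L2Z.
by congr inner; apply/funext => z; rewrite mulN1r.
Qed.

Lemma innerDr f g h : L2 f -> L2 g -> L2 h ->
  inner h (fun z => f z + g z) = inner h f + inner h g.
Proof.
move=> fL gL hL; rewrite innerC//; last exact: L2D.
by rewrite innerDl// rmorphD /= -!innerC.
Qed.

Lemma innerZr a f h : L2 f -> L2 h ->
  inner h (fun z => a * f z) = a^* * inner h f.
Proof.
move=> fL hL; rewrite innerC//; last exact: L2Z.
by rewrite innerZl// rmorphM /= -innerC.
Qed.

Lemma ae_eq_innerl f g h : L2 f -> L2 g -> L2 h ->
  {ae mu, forall z, f z = g z} -> inner f h = inner g h.
Proof.
move=> [mf _] [mg _] [mh _] fg; apply: ae_eq_cintegral.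
- by apply: measurable_mulc => //; exact: measurable_conjc.
- by apply: measurable_mulc => //; exact: measurable_conjc.
by apply: filterS fg => z ->.
Qed.

Lemma ae_eq_innerr f g h : L2 f -> L2 g -> L2 h ->
  {ae mu, forall z, f z = g z} -> inner h f = inner h g.
Proof.
by move=> fL gL hL fg; rewrite innerC// (ae_eq_innerl _ _ _ fg)// -innerC.
Qed.

Lemma sqnorm_eq0 f : L2 f -> sqnorm f = 0 -> {ae mu, forall z, f z = 0}.
Proof.
move=> fL f0; have := sqnormEFin fL; rewrite f0 => /esym.
have mf : measurable_fun setT (fun z => (sqnormc (f z))%:E).
  by apply/measurable_EFinP/measurable_sqnormc/L2_measurable.
under eq_integral do rewrite -(gee0_abs (x := (_)%:E)) ?lee_fin ?sqnormc_ge0//.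
move=> /(ae_eq_integral_abs mu measurableT mf).
apply: filterS => z /(_ Logic.I)/= [].
exact: sqnormc_eq0.
Qed.

Lemma sqnormD_inner f g : L2 f -> L2 g ->
  sqnorm (fun z => f z + g z) = sqnorm f + sqnorm g + 2 * Re (inner f g).
Proof.
move=> fL gL; have fgL := L2D fL gL.
have -> : sqnorm (fun z => f z + g z) = Re (inner (fun z => f z + g z) (fun z => f z + g z)).
  by rewrite inner_self.
rewrite innerDl// !innerDr// !inner_self (innerC gL fL) !ReImE /=; ring.
Qed.

Lemma sqnormZ a f : L2 f -> sqnorm (fun z => a * f z) = sqnormc a * sqnorm f.
Proof.
move=> fL; rewrite /sqnorm -RintegralZl//; last exact: L2_integrable.
by apply: eq_Rintegral => z _; rewrite sqnormcM.
Qed.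

Lemma sqnormB_inner a f g : L2 f -> L2 g ->
  sqnorm (f \- (fun z => a * g z)) =
  sqnorm f + sqnormc a * sqnorm g - 2 * Re (a^* * inner f g).
Proof.
move=> fL gL.
have -> : f \- (fun z => a * g z) = (fun z => f z + (- a) * g z).
  by apply/funext => z; rewrite /= mulNr.
rewrite sqnormD_inner//; last exact: L2Z.
rewrite sqnormZ// innerZr// /sqnormc !ReImE; ring.
Qed.

(** Expand |f - <f, h> h|^2 >= 0. *)
Lemma bessel1 f h : L2 f -> L2 h -> sqnorm h = 1 ->
  sqnormc (inner f h) <= sqnorm f.
Proof.
move=> fL hL h1; have := sqnorm_ge0 (f \- (fun z => inner f h * h z)).
rewrite sqnormB_inner// h1 mulrC mul1r /sqnormc !ReImE; lra.
Qed.

End SquareIntegrable.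

(** * Fatou and Riesz-Fischer *)

Section Fatou.
Context d (T : measurableType d) (R : realType).
Variable mu : {measure set T -> \bar R}.

(** Fatou's lemma, for a sequence which converges almost everywhere. *)
Lemma ae_cvg_integral_le (u : nat -> T -> \bar R) (v : T -> \bar R) (c : \bar R) :
  (forall n, measurable_fun setT (u n)) -> measurable_fun setT v ->
  (forall n x, (0 <= u n x)%E) -> (forall x, (0 <= v x)%E) ->
  {ae mu, forall x, u n x @[n --> \oo] --> v x} ->
  (forall n, (\int[mu]_x u n x <= c)%E) -> (\int[mu]_x v x <= c)%E.
Proof.
move=> mu_ mv u0 v0 uv uc.
have ml : measurable_fun setT (fun x => limn_einf (u^~ x)).
  have -> : (fun x => limn_einf (u^~ x)) =
      (fun x => - limn_esup (fun n => - u n x))%E by [].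
  apply: measurableT_comp => //; apply: measurable_fun_limn_esup => n.
  exact: measurableT_comp.
have uvl : {ae mu, forall x, setT x -> v x = limn_einf (u^~ x)}.
  by apply: filterS uv => x /cvg_limn_einf_sup[-> _].
have l0 x : (0 <= limn_einf (u^~ x))%E.
  rewrite limn_einf_lim; apply: lime_ge; first exact: is_cvg_einfs.
  by apply: nearW => n; apply: le_ereal_inf_tmp => _ [k _ <-].
rewrite (ge0_ae_eq_integral measurableT mv ml)//.
apply: le_trans (fatou mu measurableT mu_ _) _ => //.
rewrite limn_einf_lim; apply: lime_le; first exact: is_cvg_einfs.
apply: nearW => n; apply: le_trans (uc n).
by apply: ereal_inf_lbound; exists n => /=.
Qed.

(** The sum of the series has a finite integral, hence is finite almost
    everywhere. *)
Lemma ae_cvg_series (u : nat -> T -> R) (a : nat -> R) (c : R) :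
  (forall n, measurable_fun setT (u n)) -> (forall n x, 0 <= u n x) ->
  (forall n, (\int[mu]_x (u n x)%:E <= (a n)%:E)%E) ->
  (forall n, \sum_(0 <= k < n) a k <= c) ->
  {ae mu, forall x, cvgn (series (u^~ x))}.
Proof.
move=> mu_ u0 ua ac.
pose S x := (\sum_(0 <= n <oo) (u n x)%:E)%E.
have S0 x : (0 <= S x)%E by apply: nneseries_ge0 => n _ _; rewrite lee_fin.
have mS : measurable_fun setT S.
  apply: ge0_emeasurable_sum => n; first by move=> x _ _; rewrite lee_fin.
  by move=> _; exact/measurable_EFinP.
have SI : mu.-integrable setT S.
  apply/integrableP; split=> //.
  under eq_integral do rewrite gee0_abs//.
  rewrite integral_nneseries//; last 2 first.
  - by move=> n; exact/measurable_EFinP.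
  - by move=> n x _; rewrite lee_fin.
  apply: (@le_lt_trans _ _ c%:E); last exact: ltry.
  apply: lime_le.
    by apply: is_cvg_nneseries => n _ _; apply: integral_ge0 => x _; rewrite lee_fin.
  apply: nearW => n; apply: (@le_trans _ _ (\sum_(0 <= k < n) (a k)%:E)%E).
    exact: lee_sum.
  by rewrite sumEFin lee_fin.
apply: filterS (integrable_ae measurableT SI) => x /(_ Logic.I) Sx.
apply: nondecreasing_is_cvgn.
  by apply: nondecreasing_series => n _ _.
exists (fine (S x)) => _ [n _ <-]; rewrite -lee_fin fineK// -sumEFin.
by apply: nneseries_lim_ge => k _ _; rewrite lee_fin.
Qed.

End Fatou.

Section RieszFischer.
Context (R : realType).
Implicit Types (f g h : R[i] -> R[i]) (a : R[i]).
Local Notation mu := (@circle_measure R).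
Local Notation L2 := (@Lcircle R 2%:E).

Definition ae_cvg_to (u : nat -> R[i] -> R[i]) (v : R[i] -> R[i]) :=
  {ae mu, forall z, Re (u n z) @[n --> \oo] --> Re (v z) /\
                    Im (u n z) @[n --> \oo] --> Im (v z)}.

Lemma ae_cvg_sqnorm_le (u : nat -> R[i] -> R[i]) v (c : R) :
  (forall n, L2 (u n)) -> measurable_fun setT v -> ae_cvg_to u v ->
  (forall n, sqnorm (u n) <= c) -> L2 v /\ sqnorm v <= c.
Proof.
move=> uL mv uv uc.
have ivc : (\int[mu]_z (sqnormc (v z))%:E <= c%:E)%E.
  apply: (@ae_cvg_integral_le _ _ _ mu (fun n z => (sqnormc (u n z))%:E)).
  - by move=> n; apply/measurable_EFinP/measurable_sqnormc/L2_measurable.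
  - exact/measurable_EFinP/measurable_sqnormc.
  - by move=> n z; rewrite lee_fin sqnormc_ge0.
  - by move=> z; rewrite lee_fin sqnormc_ge0.
  - apply: filterS uv => z [ur ui]; apply: cvg_EFin; first exact: nearW.
    by apply: cvgD; [exact: (cvgM ur ur)|exact: (cvgM ui ui)].
  - by move=> n; rewrite -sqnormEFin// lee_fin.
have vL : L2 v.
  apply/L2P; split=> //; apply/integrableP; split.
    exact/measurable_EFinP/measurable_sqnormc.
  under eq_integral do rewrite gee0_abs ?lee_fin ?sqnormc_ge0//.
  exact: le_lt_trans ivc (ltry _).
by split=> //; rewrite -lee_fin sqnormEFin.
Qed.

(** On a probability space |d|_1 <= |d|_2, so increments of L^2 norm 2^-n are
    summable in L^1, hence absolutely summable at almost every point. *)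
Lemma L2_fast_cauchy_cvg (u : nat -> R[i] -> R[i]) :
  (forall n, L2 (u n)) ->
  (forall n, sqnorm (u n.+1 \- u n) <= (4^-1) ^+ n) ->
  exists v, measurable_fun setT v /\ ae_cvg_to u v.
Proof.
move=> uL uC.
pose w n z : R := `|Re (u n.+1 z) - Re (u n z)| + `|Im (u n.+1 z) - Im (u n z)|.
have w0 n z : 0 <= w n z by rewrite addr_ge0.
have mr n : measurable_fun setT (fun z => Re (u n z)).
  by have [/measurable_complexP[]] := uL n.
have mi n : measurable_fun setT (fun z => Im (u n z)).
  by have [/measurable_complexP[]] := uL n.
have mw n : measurable_fun setT (w n).
  by apply: measurable_funD; apply: measurableT_comp => //; exact: measurable_funB.
pose b n : R := 2 * 2^-1 ^+ n.
have wb n : (\int[mu]_z (w n z)%:E <= (b n)%:E)%E.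
  have dL : L2 (u n.+1 \- u n) by exact: L2B.
  have di : mu.-integrable setT (fun z => ((2 ^+ n)%:E * (sqnormc ((u n.+1 \- u n) z))%:E)%E).
    by apply: integrableZl => //; exact: L2_integrable.
  have ci : mu.-integrable setT (EFin \o cst (2^-1 ^+ n : R)).
    exact: finite_measure_integrable_cst.
  (* |x| <= (2^n x^2 + 2^-n) / 2 replaces Cauchy-Schwarz *)
  apply: (@le_trans _ _ (\int[mu]_z ((2 ^+ n)%:E *
      (sqnormc ((u n.+1 \- u n) z))%:E + (2^-1 ^+ n)%:E))%E).
    apply: ge0_le_integral => //.
    - by move=> z _; rewrite lee_fin.
    - exact/measurable_EFinP.
    - by apply: (measurable_int mu); exact: (integrableD measurableT di ci).
    move=> z _; rewrite -EFinM -EFinD lee_fin /w /sqnormc !ReImE.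
    have n2 : 2^-1 ^+ n * 2 ^+ n = 1 :> R by rewrite -exprMn mulVf ?expr1n.
    have n0 : 0 < 2 ^+ n :> R by rewrite exprn_gt0.
    rewrite -(real_normK (num_real (Re (u n.+1 z) - Re (u n z)))).
    rewrite -(real_normK (num_real (Im (u n.+1 z) - Im (u n z)))).
    move: (`|Re _ - _|) (`|Im _ - _|) n2 n0 => s t.
    move: (2 ^+ n) (2^-1 ^+ n) => x y xy x0.
    rewrite -(ler_pM2l x0).
    have := sqr_ge0 (x * s - 2^-1); have := sqr_ge0 (x * t - 2^-1); lra.
  rewrite (integralD measurableT di ci) integralZl//; last exact: L2_integrable.
  rewrite -sqnormEFin// /= integral_cst//= probability_setT mule1 -EFinM -EFinD lee_fin.
  rewrite /b mulr_natl mulr2n lerD2r.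
  apply: le_trans (_ : 2 ^+ n * (4^-1) ^+ n <= _).
    by rewrite ler_pM2l// exprn_gt0.
  by rewrite -exprMn (_ : 2 * 4^-1 = 2^-1 :> R)//; lra.
have bS n : \sum_(0 <= k < n) b k <= 4.
  have -> : \sum_(0 <= k < n) b k = series (geometric 2 2^-1) n by [].
  apply: le_trans (geometric_le_lim _ _ _ _) _ => //.
    by rewrite ger0_norm ?invr_ge0// invf_lt1// ltr1n.
  have -> : 1 - 2^-1 = 2^-1 :> R by lra.
  by rewrite invrK; lra.
have wcvg := ae_cvg_series mw w0 wb bS.
have real_cvg (x : nat -> R) (y : nat -> R) : (forall n, `|x n.+1 - x n| <= y n) ->
    cvgn (series y) -> cvgn x.
  move=> xy cy.
  have : cvgn (series (telescope x)).
    apply: normed_cvg; apply: series_le_cvg cy => n.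
    - exact: normr_ge0.
    - exact: le_trans (normr_ge0 _) (xy n).
    - exact: xy.
  rewrite telescopeK => /cvg_ex[l xl]; apply/cvg_ex; exists (l + x 0%N).
  have xE : (fun n => [sequence x n - x 0%N]_n n + x 0%N) = x.
    by apply/funext => n /=; rewrite subrK.
  rewrite -[X in X @ _ --> _]xE.
  by apply: cvgD; [exact: xl|exact: cvg_cst].
(* the upper limit is measurable everywhere, and is the limit where it exists *)
exists (fun z => Complex (fine (limn_esup (fun n => (Re (u n z))%:E)))
                         (fine (limn_esup (fun n => (Im (u n z))%:E)))).
split.
  apply/measurable_complexP; split => /=.
    apply: measurableT_comp => //; apply: measurable_fun_limn_esup => n.
    exact/measurable_EFinP.
  apply: measurableT_comp => //; apply: measurable_fun_limn_esup => n.
  exact/measurable_EFinP.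
have esup_cvg (x : nat -> R) : cvgn x ->
    x n @[n --> \oo] --> fine (limn_esup (fun n => (x n)%:E)).
  move=> /cvg_ex[l xl].
  have [_ ->//] : ((limn_einf (fun n => (x n)%:E) = l%:E) *
                (limn_esup (fun n => (x n)%:E) = l%:E))%type.
  by apply: cvg_limn_einf_sup; apply: cvg_EFin => //; exact: nearW.
apply: filterS wcvg => z cz; split; apply: esup_cvg; apply: real_cvg cz => n.
  by rewrite /w lerDl.
by rewrite /w lerDr.
Qed.

Lemma ae_cvg_to_subl f u v : ae_cvg_to u v -> ae_cvg_to (fun n => f \- u n) (f \- v).
Proof.
apply: filterS => z [ur ui]; split.
  rewrite /= ReD ReN; under eq_fun do rewrite ReD ReN.
  by apply: cvgB => //; exact: cvg_cst.
rewrite /= ImD ImN; under eq_fun do rewrite ImD ImN.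
by apply: cvgB => //; exact: cvg_cst.
Qed.

Lemma ae_cvg_to_subr f u v : ae_cvg_to u v -> ae_cvg_to (fun n => u n \- f) (v \- f).
Proof.
apply: filterS => z [ur ui]; split.
  rewrite /= ReD ReN; under eq_fun do rewrite ReD ReN.
  by apply: cvgB => //; exact: cvg_cst.
rewrite /= ImD ImN; under eq_fun do rewrite ImD ImN.
by apply: cvgB => //; exact: cvg_cst.
Qed.

Lemma ae_cvg_to_shift (N : nat) u v : ae_cvg_to u v -> ae_cvg_to (fun n => u (n + N)%N) v.
Proof.
apply: filterS => z [ur ui]; split.
  by have := ur; rewrite -(cvg_shiftn N).
by have := ui; rewrite -(cvg_shiftn N).
Qed.

End RieszFischer.

(** * Orthogonal projection onto a closed subspace *)

Section Projection.
Context (R : realType).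
Implicit Types (f g h : R[i] -> R[i]) (a : R[i]).
Local Notation mu := (@circle_measure R).
Local Notation L2 := (@Lcircle R 2%:E).

Lemma parallelogram f g : L2 f -> L2 g ->
  sqnorm (f \- g) = 2 * sqnorm f + 2 * sqnorm g - sqnorm (fun z => f z + g z).
Proof.
move=> fL gL; rewrite sqnormD_inner//.
have -> : f \- g = f \- (fun z => 1 * g z).
  by apply/funext => z /=; rewrite mul1r.
by rewrite sqnormB_inner// /sqnormc !ReImE; ring.
Qed.

(** Comparing f with f - t <f, h> h for the small value t = 1 / (1 + |h|^2)
    contradicts minimality unless <f, h> = 0. *)
Lemma minimal_orthogonal f h : L2 f -> L2 h ->
  (forall a, sqnorm f <= sqnorm (f \- (fun z => a * h z))) -> inner f h = 0.
Proof.
move=> fL hL fmin; apply: sqnormc_eq0.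
set c := inner f h; have N0 := sqnorm_ge0 h.
have /(_ (Complex (1 + sqnorm h)^-1 0 * c)) := fmin.
rewrite sqnormB_inner// -/c.
have := sqnormc_ge0 c.
have e1 : (1 + sqnorm h)^-1 * (1 + sqnorm h) = 1 by rewrite mulVf// gt_eqF//; lra.
have e0 : 0 < (1 + sqnorm h)^-1 by rewrite invr_gt0; lra.
rewrite sqnormcM; have -> : sqnormc (Complex (1 + sqnorm h)^-1 0) = (1 + sqnorm h)^-1 ^+ 2.
  by rewrite /sqnormc/= expr0n addr0.
have -> : Re ((Complex (1 + sqnorm h)^-1 0 * c)^* * c) = (1 + sqnorm h)^-1 * sqnormc c.
  by rewrite /sqnormc !ReImE /=; ring.
move: (sqnormc c) (sqnorm h) ((1 + sqnorm h)^-1) e1 e0 N0 (sqnorm f) => s N t e1 t0 N0 F s0 H.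
have tN : t * N = 1 - t by lra.
have : t ^+ 2 * s * N = t * s - t ^+ 2 * s.
  by transitivity (t * s * (t * N)); [ring|rewrite tN; ring].
move=> E; have {E}H : t * s * (1 + t) <= 0 by lra.
apply/eqP; rewrite eq_le s0 andbT leNgt; apply/negP => sp.
by move: H; rewrite leNgt => /negP; apply; rewrite !mulr_gt0//; lra.
Qed.

(** A minimizing sequence in a closed subspace is Cauchy by the parallelogram
    identity; its almost everywhere limit realizes the distance, and a point
    of minimal distance is the orthogonal projection. *)
Lemma orthogonal_projection_exists (H : set (R[i] -> R[i])) :
  (forall h, H h -> L2 h) -> H (fun=> 0) ->
  (forall a g h, H g -> H h -> H (fun z => a * g z + h z)) ->
  (forall g, L2 g ->
    (forall e : R, 0 < e -> exists2 h, H h & sqnorm (g \- h) <= e) -> H g) ->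
  forall f, L2 f -> exists g, H g /\ forall h, H h -> inner (f \- g) h = 0.
Proof.
move=> HL H0 HZD Hcl f fL.
have HZ a h : H h -> H (fun z => a * h z).
  move=> Hh; have := HZD a _ _ Hh H0; congr H.
  by apply/funext => z; rewrite addr0.
pose D := [set sqnorm (f \- h) | h in H].
have Dinf : has_inf D.
  split; first by exists (sqnorm (f \- (fun=> 0))), (fun=> 0).
  by exists 0 => _ [h _ <-]; exact: sqnorm_ge0.
have Dle h : H h -> inf D <= sqnorm (f \- h).
  by move=> Hh; apply: ge_inf; [case: Dinf|exists h].
(* with errors e n, the parallelogram identity bounds the squared distance from
   u m to u n, for m <= n, by 4 e m = 4^-m *)
pose e n : R := 4^-1 * 4^-1 ^+ n.
have e0 n : 0 < e n by rewrite mulr_gt0 ?exprn_gt0.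
have e_anti m n : (m <= n)%N -> e n <= e m.
  move=> mn; rewrite ler_pM2l// ler_wiXn2l//; lra.
have /(_ _)/cid-/all_sig[u uP] : forall n, exists h, H h /\ sqnorm (f \- h) <= inf D + e n.
  move=> n; have [_ [h Hh <-] hn] := inf_adherent (e0 n) Dinf.
  by exists h; split=> //; exact: ltW.
have uL n : L2 (u n) by apply: HL; case: (uP n).
have fuL n : L2 (f \- u n) by exact: L2B.
have uC m n : (m <= n)%N -> sqnorm (u n \- u m) <= 4^-1 ^+ m.
  move=> mn.
  have -> : u n \- u m = (f \- u m) \- (f \- u n).
    by apply/funext => z /=; rewrite opprB [RHS]addrC addrA subrK.
  rewrite parallelogram//.
  pose mid z := 2^-1 * u m z + 2^-1 * u n z.
  have Hmid : H mid.
    by apply: HZD; [case: (uP m)|apply: HZ; case: (uP n)].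
  have -> : (fun z => (f \- u m) z + (f \- u n) z) =
            (fun z => 2 * (f \- mid) z).
    by apply/funext => z /=; rewrite /mid; field.
  rewrite sqnormZ; last by apply: L2B => //; exact: HL.
  have -> : sqnormc (2 : R[i]) = 4 by rewrite /sqnormc/=; ring.
  have := Dle _ Hmid; have [_] := uP m; have [_] := uP n.
  have := e_anti _ _ mn; have -> : 4^-1 ^+ m = 4 * e m by rewrite /e; field.
  lra.
have [g [mg ug]] := L2_fast_cauchy_cvg uL (fun n => uC n n.+1 (leqnSn n)).
have close N : L2 (g \- u N) /\ sqnorm (g \- u N) <= 4^-1 ^+ N.
  apply: (ae_cvg_sqnorm_le _ _
    (ae_cvg_to_shift N (ae_cvg_to_subr (u N) ug))) => [n||n].
  - exact: L2B.
  - by apply: measurable_addc => //; apply: measurable_oppc; have [] := uL N.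
  - by apply: uC; exact: leq_addl.
have gL : L2 g.
  have -> : g = (fun z => (g \- u 0%N) z + u 0%N z).
    by apply/funext => z /=; rewrite subrK.
  by apply: L2D => //; case: (close 0%N).
have e_small (x : R) : 0 < x -> exists n, 4^-1 ^+ n <= x.
  move=> x0; have : (4^-1 ^+ n : R) @[n --> \oo] --> 0.
    by apply: cvg_expr; rewrite ger0_norm//; lra.
  move=> /cvgr0_norm_le/(_ _ x0)[n _ /(_ n (leqnn n))] /=.
  by rewrite ger0_norm ?exprn_ge0// => ?; exists n.
have Hg : H g.
  apply: Hcl => // x x0; have [n nx] := e_small x x0.
  by exists (u n); [case: (uP n)|have [_ /le_trans->] := close n].
have fgmin : sqnorm (f \- g) <= inf D.
  apply/ler_addgt0Pr => x x0; have [n nx] := e_small x x0.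
  have [|||_ /le_trans] := ae_cvg_sqnorm_le (c := inf D + e n) _ _
    (ae_cvg_to_shift n (ae_cvg_to_subl f ug)).
  - by move=> k; exact: fuL.
  - by case: (L2B fL gL).
  - move=> k; have [_ /le_trans] := uP (k + n)%N; apply.
    by rewrite lerD2l e_anti// leq_addl.
  apply; rewrite lerD2l (le_trans _ nx)// /e ler_piMl ?exprn_ge0//; lra.
exists g; split=> // h Hh; apply: minimal_orthogonal; [exact: L2B|exact: HL|].
move=> a; apply: le_trans fgmin _.
have -> : (f \- g) \- (fun z => a * h z) = f \- (fun z => a * h z + g z).
  by apply/funext => z /=; rewrite opprD addrAC addrA.
by apply: Dle; exact: HZD.
Qed.

End Projection.

(** * Arc length on the unit circle *)

Section CircleMeasure.
Context (R : realType).
Local Notation mu := (@circle_measure R).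

Definition circle : set R[i] := [set z | sqnormc z = 1].

Lemma measurable_circle : measurable circle.
Proof.
have m : measurable_fun setT (fun z : R[i] => sqnormc z).
  by apply: measurable_sqnormc; exact: measurable_id.
rewrite -[circle]setTI; exact: (m measurableT _ (measurable_set1 (1 : R))).
Qed.

Lemma circle_expi (t : R) : circle (expi t).
Proof. by rewrite /circle/= /sqnormc/= cos2Dsin2. Qed.

Lemma ae_circle : {ae mu, forall z, circle z}.
Proof.
exists (~` circle); split => //; first exact/measurableC/measurable_circle.
have -> : mu (~` circle) = uniform_prob pi2_gt0 (@expi R @^-1` (~` circle)) by [].
rewrite (_ : _ @^-1` _ = set0) ?measure0//.
by apply/seteqP; split => // t /=; apply; exact: circle_expi.
Qed.

Lemma ae_eq_circle (f g : R[i] -> R[i]) : (forall z, circle z -> f z = g z) ->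
  {ae mu, forall z, f z = g z}.
Proof. by move=> fg; apply: filterS ae_circle => z /fg. Qed.

Lemma circle_neq0 z : circle z -> z != 0.
Proof.
move=> z1; apply/eqP => z0; move: z1; rewrite /circle/= z0 /sqnormc/=.
by rewrite expr0n/= addr0 => /esym/eqP; rewrite oner_eq0.
Qed.

Lemma circle_inv z : circle z -> z^-1 = z^*.
Proof.
move=> z1; apply: (mulfI (circle_neq0 z1)).
by rewrite divff ?circle_neq0// mul_conjc z1.
Qed.

Lemma circleX z n : circle z -> circle (z ^+ n).
Proof.
move=> z1; elim: n => [|n IH]; first by rewrite /circle/= /sqnormc/= expr1n expr0n addr0.
by rewrite exprS /circle/= sqnormcM z1 IH mulr1.
Qed.

Lemma circleV z : circle z -> circle z^-1.
Proof. by move=> z1; rewrite circle_inv// /circle/= sqnormc_conj. Qed.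

Lemma circle_exprz z (n : int) : circle z -> circle (z ^ n).
Proof. by move=> z1; case: n => n; [exact: circleX|exact/circleV/circleX]. Qed.

Lemma circle_conj_exprz z (n : int) : circle z -> (z ^ n)^* = z ^ (- n).
Proof.
by move=> z1; rewrite -circle_inv ?invr_expz//; exact: circle_exprz.
Qed.

Lemma expiD (s t : R) : expi (s + t) = expi s * expi t.
Proof. by apply: eqC; rewrite /= ?cosD ?sinD; ring. Qed.

Lemma expi_exprz (t : R) (n : int) : expi t ^ n = expi (n%:~R * t).
Proof.
have eX k : expi t ^+ k = expi (k%:R * t).
  elim: k => [|k IH]; first by rewrite mul0r /expi cos0 sin0.
  by rewrite exprS IH -expiD -[k.+1]add1n natrD mulrDl mul1r.
case: n => k; first exact: eX.
rewrite -[LHS]/((expi t ^+ k.+1)^-1) eX circle_inv; last exact: circle_expi.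
by rewrite NegzE mulrNz mulNr; apply: eqC => /=; rewrite ?cosN ?sinN.
Qed.

(** The phase c treats Re z^n (c = 0) and Im z^n (c = - pi / 2) together. *)
Lemma integral_circle_cos (g : R[i] -> R) (n : int) (c : R) : n != 0 ->
  measurable_fun setT g -> (forall t, g (expi t) = cos (n%:~R * t + c)) ->
  mu.-integrable setT (EFin \o g) -> \int[mu]_z g z = 0.
Proof.
move=> n0 mg gE gi; have n0' : n%:~R != 0 :> R by rewrite intr_eq0.
(* adding 1 makes the integrand nonnegative on the circle, as needed to express
   the integral through Lebesgue measure on [0, 2 pi] *)
suff H : (\int[mu]_z (1 + g z)%:E = 1)%E.
  have mT : fine (mu setT) = 1 by rewrite probability_setT.
  have ci : mu.-integrable setT (EFin \o cst (1 : R)) by exact: finite_measure_integrable_cst.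
  have := @RintegralD _ _ _ mu setT (cst 1) g measurableT ci gi.
  rewrite {1}/Rintegral H /= Rintegral_cst// (_ : fine _ = 1) ?mulr1; last exact: mT.
  by move: (\int[mu]_z g z) => I e; lra.
have cc : continuous (fun t : R => cos (n%:~R * t + c)).
  move=> t; apply: continuous_comp; last exact: continuous_cos.
  by apply: cvgD; [apply: cvgM; [exact: cvg_cst|exact: cvg_id]|exact: cvg_cst].
have mc : measurable_fun setT (fun t : R => cos (n%:~R * t + c)).
  exact: continuous_measurable_fun.
rewrite integral_distribution; last 2 first.
- by apply/measurable_EFinP; apply: measurable_funD.
- have -> : ((fun z => (1 + g z)%:E) \o expi) = EFin \o (fun t => 1 + cos (n%:~R * t + c)).
    by apply/funext => t /=; rewrite gE.
  apply: measurable_bounded_integrable => //.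
  + by apply: (@le_lt_trans _ _ 1%E); [exact: probability_le1|exact: ltry].
  + exact: measurable_funD.
  exists 2; split; first exact: num_real.
  move=> M M2 t _ /=; apply: le_trans (ltW M2); rewrite ler_norml.
  by have := cos_le1 (n%:~R * t + c); have := cos_geN1 (n%:~R * t + c); lra.
have -> : ((fun z => (1 + g z)%:E) \o expi) = EFin \o (fun t => 1 + cos (n%:~R * t + c)).
  by apply/funext => t /=; rewrite gE.
rewrite integral_uniform; last 2 first.
- exact/measurable_EFinP/measurable_funD.
- by move=> t; rewrite lee_fin; have := cos_geN1 (n%:~R * t + c); lra.
pose F (t : R) := t + n%:~R^-1 * sin (n%:~R * t + c).
have dF (t : R) : is_derive t 1 F (1 + cos (n%:~R * t + c)).
  have dl : is_derive t 1 (fun t => n%:~R * t + c) n%:~R.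
    have := is_deriveD (is_deriveZ n%:~R (is_derive_id t (1 : R))) (is_derive_cst c t 1).
    by rewrite addr0 /GRing.scale/= mulr1.
  have ds := @is_derive1_comp _ _ (fun t => n%:~R * t + c) t _ _
    (is_derive_sin (n%:~R * t + c)) dl.
  have := is_deriveD (is_derive_id t (1 : R)) (is_deriveZ n%:~R^-1 ds).
  by rewrite /GRing.scale/= mulrCA mulVf// mulr1.
have cF : continuous F.
  by move=> t; apply: differentiable_continuous; apply/derivable1_diffP.
rewrite (@continuous_FTC2 _ _ F); last 4 first.
- exact: pi2_gt0.
- apply: continuous_subspaceT => t.
  by apply: cvgD; [exact: cvg_cst|exact: cc].
- split.
  + by move=> t _; exact: (@ex_derive _ _ _ _ _ _ _ (dF t)).
  + by apply: cvg_at_right_filter; exact: cF.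
  + by apply: cvg_at_left_filter; exact: cF.
- by move=> t _; rewrite derive1E; exact: derive_val.
have e1 : expi (n%:~R * (pi *+ 2)) = 1 :> R[i].
  rewrite -expi_exprz (_ : expi _ = 1) ?exp1rz//.
  by rewrite /expi cos2pi sin2pi.
have [c1 s0] : cos (n%:~R * (pi *+ 2)) = 1 :> R /\ sin (n%:~R * (pi *+ 2)) = 0 :> R.
  by case: e1 => -> ->.
rewrite /F sinD c1 s0 mul0r mul1r add0r mulr0 !add0r subr0 -EFinB addrK -EFinM.
by rewrite mulVf// gt_eqF// pi2_gt0.
Qed.

End CircleMeasure.

(** * The Hardy space and its projection *)

Section Hardy.
Context (R : realType).
Implicit Types (f g h : R[i] -> R[i]) (a : R[i]).
Local Notation mu := (@circle_measure R).
Local Notation L2 := (@Lcircle R 2%:E).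
Local Notation H2 := (@Hardy2 R).

Lemma measurable_exprz (n : int) : measurable_fun setT (fun z : R[i] => z ^ n).
Proof. by apply: measurable_exprzc; exact: measurable_id. Qed.

Lemma L2_exprz (n : int) : L2 (fun z : R[i] => z ^ n).
Proof.
apply: (@L2_le _ _ (fun=> 1)); first exact: measurable_exprz.
  exact: finite_measure_integrable_cst.
by apply: filterS (@ae_circle R) => z /(@circle_exprz _ _ n) ->.
Qed.

Lemma sqnorm_exprz (n : int) : sqnorm (fun z : R[i] => z ^ n) = 1.
Proof.
apply: EFin_inj; rewrite sqnormEFin; last exact: L2_exprz.
rewrite (@ae_eq_integral _ _ _ _ _ (cst 1%E))//.
- by rewrite integral_cst// mul1e; exact: probability_setT.
- exact/measurable_EFinP/measurable_sqnormc/measurable_exprz.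
- by apply: filterS (@ae_circle R) => z /(@circle_exprz _ _ n) -> _.
Qed.

Lemma cintegrable_exprz (n : int) : cintegrable (fun z : R[i] => z ^ n).
Proof.
have := cintegrable_mul (L2_exprz n) (L2_cst 1).
by congr cintegrable; apply/funext => z; rewrite conjC1 mulr1.
Qed.

Lemma moment_circle (n : int) : n != 0 -> cintegral (fun z : R[i] => z ^ n) = 0.
Proof.
move=> n0; have [ir ii] := cintegrable_exprz n.
have /measurable_complexP[mr mi] := measurable_exprz n.
apply: eqC => /=.
  apply: (@integral_circle_cos _ _ n 0) => // t.
  by rewrite expi_exprz addr0.
apply: (@integral_circle_cos _ _ n (- (pi / 2))) => // t.
by rewrite expi_exprz cosBpihalf.
Qed.

Lemma fourier_coef_exprz (n m : int) : n != m ->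
  fourier_coef (fun z : R[i] => z ^ n) m = 0.
Proof.
move=> nm; rewrite -(@moment_circle (n - m)) ?subr_eq0//.
apply: ae_eq_cintegral.
- apply: measurable_mulc; first exact: measurable_exprz.
  by apply: measurable_conjc; exact: measurable_exprz.
- exact: measurable_exprz.
apply: ae_eq_circle => z z1.
by rewrite circle_conj_exprz// -expfzDr// circle_neq0.
Qed.

Lemma Hardy2_L2 f : H2 f -> L2 f. Proof. by case. Qed.

Lemma Hardy2_exprn (n : nat) : H2 (fun z => z ^ n).
Proof.
split; first exact: L2_exprz.
by move=> m m0; apply: fourier_coef_exprz; apply: contraTneq m0 => <-.
Qed.

Lemma Hardy2_0 : H2 (fun=> 0).
Proof.
split; first exact: L2_cst.
move=> n _; rewrite /fourier_coef.
rewrite (_ : (fun=> 0) = (fun z : R[i] => 0 * z ^ 0)); last first.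
  by apply/funext => z; rewrite mul0r.
by rewrite innerZl ?mul0r//; exact: L2_exprz.
Qed.

Lemma Hardy2_ZD a f g : H2 f -> H2 g -> H2 (fun z => a * f z + g z).
Proof.
move=> [fL f0] [gL g0]; split; first by apply: L2D => //; exact: L2Z.
move=> n n0; have eL := L2_exprz n.
have := f0 n n0; have := g0 n n0; rewrite /fourier_coef => gn fn.
by rewrite innerDl//; [rewrite innerZl// fn gn mulr0 addr0|exact: L2Z].
Qed.

Lemma Hardy2_B f g : H2 f -> H2 g -> H2 (f \- g).
Proof.
move=> fH gH; have := Hardy2_ZD (- 1) gH fH; congr H2.
by apply/funext => z; rewrite /= mulN1r addrC.
Qed.

(** Fourier coefficients are continuous on L^2 by Bessel's inequality. *)
Lemma Hardy2_closed g : L2 g ->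
  (forall e : R, 0 < e -> exists2 h, H2 h & sqnorm (g \- h) <= e) -> H2 g.
Proof.
move=> gL gcl; split=> // n n0; apply: sqnormc_eq0.
apply/eqP; rewrite eq_le sqnormc_ge0 andbT; apply/ler_addgt0Pr => e e0.
rewrite add0r; have [h [hL h0] ghe] := gcl e e0.
have := bessel1 (L2B gL hL) (L2_exprz n) (sqnorm_exprz n).
rewrite innerBl//; last exact: L2_exprz.
rewrite -![inner _ _]/(fourier_coef _ _) h0// subr0.
by move=> /le_trans; apply.
Qed.

Lemma proj_Hardy2P f : L2 f -> H2 (proj_Hardy2 f) /\
  forall h, H2 h -> inner (f \- proj_Hardy2 f) h = 0.
Proof.
move=> fL; have [g gP] := orthogonal_projection_exists Hardy2_L2 Hardy2_0
  Hardy2_ZD Hardy2_closed fL.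
exact: (@xgetPex _ _ [set g | H2 g /\ forall h, H2 h -> inner (f \- g) h = 0]
  (ex_intro _ g gP)).
Qed.

Lemma Hardy2_proj f : L2 f -> H2 (proj_Hardy2 f).
Proof. by case/proj_Hardy2P. Qed.

Lemma inner_proj f h : L2 f -> H2 h -> inner (proj_Hardy2 f) h = inner f h.
Proof.
move=> fL hH; have [pH /(_ _ hH)] := proj_Hardy2P fL.
rewrite innerBl//; [|exact: Hardy2_L2..].
by move=> /eqP; rewrite subr_eq0 => /eqP.
Qed.

(** The test function h = f - g forces |f - g|^2 = 0. *)
Lemma inner_Hardy2_ae_eq f g : H2 f -> H2 g ->
  (forall h, H2 h -> inner f h = inner g h) -> {ae mu, forall z, f z = g z}.
Proof.
move=> fH gH fg; have fgH := Hardy2_B fH gH.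
have : inner (f \- g) (f \- g) = 0.
  by rewrite innerBl ?fg ?subrr//; exact: Hardy2_L2.
rewrite inner_self => -[] /(sqnorm_eq0 (Hardy2_L2 fgH)).
by apply: filterS => z /eqP; rewrite subr_eq0 => /eqP.
Qed.

(** Pythagoras for f = (f - P f) + P f. *)
Lemma sqnorm_proj_le f : L2 f -> sqnorm (proj_Hardy2 f) <= sqnorm f.
Proof.
move=> fL; have pH := Hardy2_proj fL; have pL := Hardy2_L2 pH.
have [_ /(_ _ pH) orth] := proj_Hardy2P fL.
have fE : f = (fun z => (f \- proj_Hardy2 f) z + proj_Hardy2 f z).
  by apply/funext => z /=; rewrite subrK.
rewrite [in leRHS]fE sqnormD_inner//; last exact: L2B.
by rewrite orth mulr0 addr0 lerDr sqnorm_ge0.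
Qed.

End Hardy.

(** * A polynomial iteration converging to a step function *)

Section Smoothstep.
Context (R : realType).
Implicit Types (x : R).

(** On [0, 1] this map has the fixed points 0, 1/2 and 1, of which 0 and 1
    attract and 1/2 repels; its iterates thus tend to a step at 1/2. *)
Definition smoothstep x : R := x ^+ 2 * (3 - 2 * x).

Lemma smoothstep_sym x : smoothstep (1 - x) = 1 - smoothstep x.
Proof. by rewrite /smoothstep; ring. Qed.

Lemma smoothstep_bounds x : 0 <= x <= 1 -> 0 <= smoothstep x <= 1.
Proof.
move=> /andP[x0 x1]; apply/andP; split.
  by rewrite /smoothstep mulr_ge0 ?sqr_ge0//; lra.
rewrite -subr_ge0 -smoothstep_sym /smoothstep mulr_ge0 ?sqr_ge0//; lra.
Qed.

Lemma iter_smoothstep_bounds k x : 0 <= x <= 1 -> 0 <= iter k smoothstep x <= 1.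
Proof. by move=> x01; elim: k => //= k; exact: smoothstep_bounds. Qed.

(** Starting from x < 1/2 each step contracts at least by the factor
    3 x - 2 x^2 < 1. *)
Lemma iter_smoothstep_cvg0 x : 0 <= x < 2^-1 ->
  iter k smoothstep x @[k --> \oo] --> 0.
Proof.
move=> /andP[x0 x2]; pose r := x * (3 - 2 * x).
have [r0 r1] : 0 <= r /\ r < 1.
  rewrite /r; split; first by rewrite mulr_ge0//; lra.
  have : 0 < (1 - x) * (1 - 2 * x) by rewrite mulr_gt0//; lra.
  lra.
have H k : 0 <= iter k smoothstep x <= r ^+ k * x.
  elim: k => [|k IH] /=; first by rewrite expr0 mul1r x0 lexx.
  have rk : r ^+ k * x <= x by rewrite ler_piMl// exprn_ile1// ltW.
  move: IH rk; rewrite exprS -mulrA; move: (iter _ _ _) (r ^+ k * x) => y s.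
  move=> /andP[y0 ys] sx; have yx := le_trans ys sx.
  have y01 : 0 <= y <= 1 by apply/andP; split; lra.
  have /andP[-> _] /= := smoothstep_bounds y01.
  have -> : smoothstep y = y * (3 - 2 * y) * y by rewrite /smoothstep; ring.
  apply: ler_pM => //; first by rewrite mulr_ge0//; lra.
  have : 0 <= (x - y) * (3 - 2 * (x + y)) by rewrite mulr_ge0//; lra.
  rewrite /r; lra.
apply: (@squeeze_cvgr _ _ _ _ (cst 0) (fun k => r ^+ k * x)).
- by apply: nearW => k; exact: H.
- exact: cvg_cst.
- rewrite -[X in _ --> X](mul0r x); apply: cvgMl.
  by apply: cvg_expr; rewrite ger0_norm.
Qed.

(** The polynomial y (2 y - 1) sends the limit value 1/2 to 0 and fixes 0 and 1,
    so that the limit is exactly the indicator of x > 1/2. *)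
Definition smoothstep_sharp k x :=
  iter k smoothstep x * (2 * iter k smoothstep x - 1).

Lemma smoothstep_sharp_bounds k x : 0 <= x <= 1 -> `|smoothstep_sharp k x| <= 1.
Proof.
move=> /(iter_smoothstep_bounds k) /andP[]; rewrite /smoothstep_sharp.
move: (iter _ _ _) => y y0 y1; have y2 := sqr_ge0 y.
have y3 : 0 <= y * (1 - y) by rewrite mulr_ge0// subr_ge0.
by rewrite ler_norml; apply/andP; split; lra.
Qed.

Lemma smoothstep_sharp_cvg x : 0 <= x <= 1 ->
  smoothstep_sharp k x @[k --> \oo] --> (if 2^-1 < x then 1 else 0 : R).
Proof.
move=> /andP[x0 x1]; case: ltP => x2.
  have H : iter k smoothstep x @[k --> \oo] --> (1 : R).
    have E k : iter k smoothstep x = 1 - iter k smoothstep (1 - x).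
      elim: k => [|k IH] /=; first by rewrite subKr.
      by rewrite IH smoothstep_sym.
    rewrite (_ : (fun k => _) = (fun k => 1 - iter k smoothstep (1 - x))); last exact/funext.
    rewrite -[X in _ --> X](subr0 1); apply: cvgB; first exact: cvg_cst.
    by apply: iter_smoothstep_cvg0; lra.
  rewrite [X in _ --> X](_ : _ = 1 * (2 * 1 - 1)); last by ring.
  apply: cvgM => //; apply: cvgB; last exact: cvg_cst.
  by apply: cvgM => //; exact: cvg_cst.
move: x2; rewrite le_eqVlt => /predU1P[->|x2].
  have E k : smoothstep_sharp k 2^-1 = 0.
    rewrite /smoothstep_sharp (_ : iter k _ _ = 2^-1); first by field.
    by elim: k => //= k ->; rewrite /smoothstep; field.
  by under eq_cvg do rewrite E; exact: cvg_cst.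
have H : iter k smoothstep x @[k --> \oo] --> 0.
  by apply: iter_smoothstep_cvg0; rewrite x0.
rewrite [X in _ --> X](_ : _ = 0 * (2 * 0 - 1)); last by ring.
apply: cvgM => //; apply: cvgB; last exact: cvg_cst.
by apply: cvgM => //; exact: cvg_cst.
Qed.

End Smoothstep.

(** * Multipliers of a class closed under bounded limits *)

Section Multipliers.
Context (R : realType).
Implicit Types (u v : R[i] -> R[i]) (m p : R[i] -> R).
Local Notation circle := (@circle R).

Lemma circle_normr_Re z : circle z -> `|Re z| <= 1.
Proof.
move=> z1; rewrite -(@ler_pXn2r _ 2)// ?nnegrE// expr1n real_normK ?num_real//.
by rewrite -z1 sqr_Re_le.
Qed.

Lemma circle_normr_Im z : circle z -> `|Im z| <= 1.
Proof.
move=> z1; rewrite -(@ler_pXn2r _ 2)// ?nnegrE// expr1n real_normK ?num_real//.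
by rewrite -z1 sqr_Im_le.
Qed.

Definition circle_bounded u := exists C : R, forall z, circle z -> sqnormc (u z) <= C.

(** The shape shared by the kernels of the functionals u |-> int eta u dmu and
    u |-> int u dmu - int u dnu on bounded functions on the circle. *)
Record bounded_closed (K : set (R[i] -> R[i])) : Prop := BoundedClosed {
  bclosed_measurable : forall u, K u -> measurable_fun setT u;
  bclosed_bounded : forall u, K u -> circle_bounded u;
  bclosed_ZD : forall (a : R[i]) u v, K u -> K v -> K (fun z => a * u z + v z);
  bclosed_ext : forall u v, measurable_fun setT v ->
    (forall z, circle z -> u z = v z) -> K u -> K v;
  bclosed_lim : forall (u : nat -> R[i] -> R[i]) v (C : R),
    (forall n, K (u n)) -> measurable_fun setT v ->
    (forall n z, circle z -> sqnormc (u n z) <= C) ->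
    (forall z, circle z -> Re (u n z) @[n --> \oo] --> Re (v z) /\
                           Im (u n z) @[n --> \oo] --> Im (v z)) ->
    K v }.

Variable K : set (R[i] -> R[i]).
Hypothesis HK : bounded_closed K.

(** Requiring all the products by z^n to be in K makes this set stable under
    multiplication by z and 1/z, hence by Re z and Im z on the circle. *)
Definition shift_kernel u := forall n : int, K (fun z => u z * z ^ n).

Definition multiplier m := [/\ measurable_fun setT m,
  exists C, forall z, circle z -> `|m z| <= C
  & forall u, shift_kernel u -> shift_kernel (fun z => Complex (m z) 0 * u z)].

Lemma ReZ (c : R) w : Re (Complex c 0 * w) = c * Re w.
Proof. by rewrite ReM/= mul0r subr0. Qed.

Lemma ImZ (c : R) w : Im (Complex c 0 * w) = c * Im w.
Proof. by rewrite ImM/= mul0r addr0. Qed.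

Lemma measurable_real_complex m : measurable_fun setT m ->
  measurable_fun setT (fun z => Complex (m z) 0 : R[i]).
Proof. by move=> mm; apply/measurable_complexP; split. Qed.

Lemma bclosed_Z a u : K u -> K (fun z => a * u z).
Proof.
move=> Ku; apply: (bclosed_ext HK) (bclosed_ZD HK (a - 1) Ku Ku).
  by apply: measurable_mulc => //; exact: bclosed_measurable Ku.
by move=> z _; ring.
Qed.

Lemma shift_kernel_ZD a u v : shift_kernel u -> shift_kernel v ->
  shift_kernel (fun z => a * u z + v z).
Proof.
move=> Ku Kv n; have := bclosed_ZD HK a (Ku n) (Kv n).
by congr K; apply/funext => z; rewrite mulrDl mulrA.
Qed.

Lemma shift_kernel_Z a u : shift_kernel u -> shift_kernel (fun z => a * u z).
Proof.
by move=> Ku n; have := bclosed_Z a (Ku n); congr K; apply/funext => z; rewrite mulrA.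
Qed.

Lemma shift_kernel_measurable u : shift_kernel u -> measurable_fun setT u.
Proof.
move=> /(_ 0)/(bclosed_measurable HK).
by under eq_fun do rewrite expr0z mulr1.
Qed.

Lemma shift_kernel_ext u v : measurable_fun setT v ->
  (forall z, circle z -> u z = v z) -> shift_kernel u -> shift_kernel v.
Proof.
move=> mv uv Ku n; apply: (bclosed_ext HK) (Ku n).
  by apply: measurable_mulc => //; exact: measurable_exprz.
by move=> z /uv ->.
Qed.

Lemma shift_kernel_shift (k : int) u : shift_kernel u ->
  shift_kernel (fun z => z ^ k * u z).
Proof.
move=> Ku n; have mu := shift_kernel_measurable Ku.
apply: (bclosed_ext HK) (Ku (k + n)).
  apply: measurable_mulc; last exact: measurable_exprz.
  by apply: measurable_mulc => //; exact: measurable_exprz.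
by move=> z z1; rewrite expfzDr ?circle_neq0// mulrCA mulrA.
Qed.

Lemma multiplier_cst c : multiplier (fun=> c).
Proof.
split; first exact: measurable_cst; first by exists `|c|.
by move=> u Ku; exact: shift_kernel_Z.
Qed.

Lemma multiplierM m p : multiplier m -> multiplier p -> multiplier (fun z => m z * p z).
Proof.
move=> [mm [C mC] Km] [mp [D pD] Kp]; split; first exact: measurable_funM.
  exists (C * D) => z z1; rewrite normrM ler_pM//; [exact: mC|exact: pD].
move=> u /Kp/Km; congr shift_kernel; apply/funext => z.
by rewrite mulrA; congr (_ * _); apply: eqC; rewrite !ReImE/=; ring.
Qed.

Lemma multiplierD m p : multiplier m -> multiplier p -> multiplier (fun z => m z + p z).
Proof.
move=> [mm [C mC] Km] [mp [D pD] Kp]; split; first exact: measurable_funD.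
  exists (C + D) => z z1; rewrite (le_trans (ler_normD _ _))// lerD//; [exact: mC|exact: pD].
move=> u Ku; have := shift_kernel_ZD 1 (Km _ Ku) (Kp _ Ku).
congr shift_kernel; apply/funext => z.
by rewrite mul1r -mulrDl; congr (_ * _); apply: eqC; rewrite !ReImE/=; ring.
Qed.

(** Re z = (z + z^-1) / 2 on the circle. *)
Lemma multiplier_Re : multiplier (@complex.Re R).
Proof.
split; first exact: measurable_Re.
  by exists 1 => z; exact: circle_normr_Re.
move=> u Ku; have mu := shift_kernel_measurable Ku.
apply: shift_kernel_ext (shift_kernel_Z (Complex 2^-1 0)
  (shift_kernel_ZD 1 (shift_kernel_shift 1 Ku) (shift_kernel_shift (- 1) Ku))).
  by apply: measurable_mulc => //; apply/measurable_real_complex/measurable_Re.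
move=> z z1; rewrite -[z ^ (- 1)](circle_conj_exprz 1)// expr1z.
by apply: eqC; rewrite !ReImE/=; field.
Qed.

(** Im z = (z - z^-1) / (2 i) on the circle. *)
Lemma multiplier_Im : multiplier (@complex.Im R).
Proof.
split; first exact: measurable_Im.
  by exists 1 => z; exact: circle_normr_Im.
move=> u Ku; have mu := shift_kernel_measurable Ku.
apply: shift_kernel_ext (shift_kernel_Z (Complex 0 2^-1)
  (shift_kernel_ZD (- 1) (shift_kernel_shift 1 Ku) (shift_kernel_shift (- 1) Ku))).
  by apply: measurable_mulc => //; apply/measurable_real_complex/measurable_Im.
move=> z z1; rewrite -[z ^ (- 1)](circle_conj_exprz 1)// expr1z.
by apply: eqC; rewrite !ReImE/=; field.
Qed.

Lemma multiplier_lim (m : nat -> R[i] -> R) p (C : R) :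
  (forall n, multiplier (m n)) -> measurable_fun setT p ->
  (forall n z, circle z -> `|m n z| <= C) ->
  (forall z, circle z -> m n z @[n --> \oo] --> p z) -> multiplier p.
Proof.
move=> mM mp mC mlim.
have pC z : circle z -> `|p z| <= C.
  move=> z1; have /(@cvg_lim _)<-// : `|m n z| @[n --> \oo] --> `|p z|.
    by apply: cvg_norm; exact: mlim.
  apply: limr_le; last by apply: nearW => n; exact: mC.
  by apply/cvg_ex; exists `|p z|; apply: cvg_norm; exact: mlim.
split=> //; first by exists C.
move=> u Ku n; have mu := shift_kernel_measurable Ku.
have [D uD] := bclosed_bounded HK (Ku n).
apply: (@bclosed_lim _ HK (fun k z => Complex (m k z) 0 * u z * z ^ n) _ (C ^+ 2 * D)).
- by move=> k; have [_ _] := mM k; exact.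
- apply: measurable_mulc; last exact: measurable_exprz.
  by apply: measurable_mulc => //; exact: measurable_real_complex.
- move=> k z z1; rewrite -mulrA sqnormcM; apply: ler_pM; rewrite ?sqnormc_ge0//; last exact: uD.
  rewrite /sqnormc/= expr0n addr0 -real_normK ?num_real//.
  by rewrite lerXn2r ?nnegrE//; [exact: le_trans (mC k z z1)|exact: mC].
- move=> z z1; rewrite -mulrA ReZ ImZ.
  under eq_cvg do rewrite -mulrA ReZ.
  under [X in _ /\ X]eq_cvg do rewrite -mulrA ImZ.
  by split; apply: cvgMl; exact: mlim.
Qed.

End Multipliers.

(** * Such a class contains all indicator functions *)

Section Indicators.
Context (R : realType).
Implicit Types (A B : set R[i]).
Local Notation circle := (@circle R).
Variable K : set (R[i] -> R[i]).
Hypothesis HK : bounded_closed K.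
Local Notation multiplier := (multiplier K).

Lemma multiplier_iter_smoothstep m k : multiplier m ->
  multiplier (fun z => iter k (@smoothstep R) (m z)).
Proof.
move=> Km; elim: k => [//|k IH] /=; rewrite /smoothstep.
under eq_fun do rewrite expr2 -mulNr.
apply: multiplierM => //; first exact: multiplierM.
apply: multiplierD => //; first exact: multiplier_cst.
by apply: multiplierM => //; exact: multiplier_cst.
Qed.

(** An affine change of p maps the circle into [0, 1] and the level c to 1/2;
    the iterates of smoothstep then converge to the indicator. *)
Lemma multiplier_superlevel p (c : R) : multiplier p ->
  (forall z, circle z -> `|p z| <= 1) ->
  multiplier (\1_[set z | c < p z] : R[i] -> R).
Proof.
move=> Kp p1; have [mp _ _] := Kp.
pose e := (2 * (1 + `|c|))^-1; have c0 : 0 < 2 * (1 + `|c|) by rewrite mulr_gt0 ?ltr_pwDl.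
have e0 : 0 < e by rewrite invr_gt0.
have eE : e * (1 + `|c|) = 2^-1 by rewrite /e; field; rewrite gt_eqF ?ltr_pwDl.
pose h z := 2^-1 + e * (p z - c).
have Kh : multiplier h.
  apply: multiplierD => //; first exact: multiplier_cst.
  apply: multiplierM => //; first exact: multiplier_cst.
  by apply: multiplierD => //; exact: multiplier_cst.
have h01 z : circle z -> 0 <= h z <= 1.
  move=> /p1; rewrite ler_norml => /andP[pl pr].
  have := ler_norm c; have := ler_norm (- c); rewrite normrN => c1 c2.
  have H1 : 0 <= e * (1 + `|c| + (p z - c)) by apply: mulr_ge0; [exact: ltW|lra].
  have H2 : 0 <= e * (1 + `|c| - (p z - c)) by apply: mulr_ge0; [exact: ltW|lra].
  by rewrite /h; apply/andP; split; lra.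
apply: (@multiplier_lim _ _ HK (fun k z => smoothstep_sharp k (h z)) _ 1).
- move=> k; rewrite /smoothstep_sharp.
  have Ki := multiplier_iter_smoothstep k Kh.
  apply: multiplierM => //; apply: multiplierD => //; last exact: multiplier_cst.
  by apply: multiplierM => //; exact: multiplier_cst.
- apply: measurable_indic; rewrite -[X in measurable X]setTI.
  rewrite (_ : [set z | c < p z] = p @^-1` `]c, +oo[); first exact: mp.
  by apply/seteqP; split=> z /=; rewrite in_itv/= andbT.
- by move=> k z /h01; exact: smoothstep_sharp_bounds.
- move=> z /h01 /smoothstep_sharp_cvg.
  rewrite indicE /h ltrDl pmulr_rgt0// subr_gt0.
  case: ifPn => cp; first by rewrite mem_set.
  by rewrite memNset//; exact/negP.
Qed.

Definition multiplier_sets : set (set R[i]) :=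
  [set A | measurable A /\ multiplier (\1_A : R[i] -> R)].

Lemma multiplier_sets_setC A : multiplier_sets A -> multiplier_sets (~` A).
Proof.
move=> [mA KA]; split; first exact: measurableC.
have -> : (\1_(~` A) : R[i] -> R) = (fun z => 1 + -1 * \1_A z).
  apply/funext => z; rewrite !indicE; have [zA|zA] := boolP (z \in A).
    by rewrite memNset ?mulr1 ?subrr//; apply; exact: set_mem.
  have zAC : (~` A) z by move: zA; rewrite notin_setE.
  by rewrite mem_set// mulr0 addr0.
apply: multiplierD => //; first exact: multiplier_cst.
by apply: multiplierM => //; exact: multiplier_cst.
Qed.

Lemma multiplier_sets_setI A B : multiplier_sets A -> multiplier_sets B ->
  multiplier_sets (A `&` B).
Proof.
move=> [mA KA] [mB KB]; split; first exact: measurableI.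
have -> : (\1_(A `&` B) : R[i] -> R) = (fun z => \1_A z * \1_B z).
  by apply/funext => z; rewrite !indicE in_setI -natrM mulnb.
exact: multiplierM.
Qed.

Lemma multiplier_sets_setU A B : multiplier_sets A -> multiplier_sets B ->
  multiplier_sets (A `|` B).
Proof.
move=> /multiplier_sets_setC hA /multiplier_sets_setC hB.
by rewrite -[A `|` B]setCK setCU; apply/multiplier_sets_setC/multiplier_sets_setI.
Qed.

Lemma sigma_algebra_multiplier_sets : sigma_algebra setT multiplier_sets.
Proof.
have h0 : multiplier_sets set0.
  by split=> //; rewrite indic0; exact: multiplier_cst.
split=> [//|A|F hF]; first by rewrite setTD; exact: multiplier_sets_setC.
split; first by apply: bigcupT_measurable => n; case: (hF n).
pose G n := \big[setU/set0]_(k < n) F k.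
have hG n : multiplier_sets (G n).
  rewrite /G; elim: n => [|n IH]; first by rewrite big_ord0.
  by rewrite big_ord_recr/=; apply: multiplier_sets_setU.
apply: (@multiplier_lim _ _ HK (fun n => \1_(G n)) _ 1).
- by move=> n; case: (hG n).
- by apply: measurable_indic; apply: bigcupT_measurable => n; case: (hF n).
- by move=> n z _; rewrite indicE ger0_norm// lern1; case: (_ \in _).
move=> z _; rewrite indicE; have [|zF] := boolP (z \in _).
  rewrite inE => -[n _ Fnz].
  apply: (@cvg_trans _ ((fun=> 1 : R) @ \oo)); last exact: cvg_cst.
  apply: near_eq_cvg; exists n.+1 => // k /= nk.
  by rewrite indicE mem_set// /G -bigcup_mkord; exists n.
have E n : \1_(G n) z = 0 :> R.
  rewrite indicE memNset// /G -bigcup_mkord => -[k _ Fkz].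
  by move: zF; rewrite notin_setE; apply; exists k.
by under eq_cvg do rewrite E; exact: cvg_cst.
Qed.

Lemma multiplier_sets_preimage p (B : set R) : multiplier p ->
  (forall z, circle z -> `|p z| <= 1) -> measurable B -> multiplier_sets (p @^-1` B).
Proof.
move=> Kp p1 mB; have [mp _ _] := Kp.
have sB := sigma_algebra_image p sigma_algebra_multiplier_sets.
suff : image_set_system setT p multiplier_sets B by rewrite /image_set_system/= setTI.
have : (@RGenOInfty.G R).-sigma.-measurable B by rewrite -RGenOInfty.measurableE.
move: B {mB}; apply: smallest_sub => // _ [c ->] /=.
rewrite /image_set_system/= setTI; split.
  by rewrite -[X in measurable X]setTI; exact: mp.
have := multiplier_superlevel c Kp p1; congr (multiplier (\1__)).
by apply/seteqP; split=> z /=; rewrite in_itv/= andbT.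
Qed.

Lemma measurable_multiplier_sets A : measurable A -> multiplier_sets A.
Proof.
move=> [B mB <-].
have sB := sigma_algebra_image (@complex_pair R) sigma_algebra_multiplier_sets.
suff : image_set_system setT (@complex_pair R) multiplier_sets B by [].
move: B mB; rewrite measurable_prod_measurableType.
apply: smallest_sub => // _ [C mC [D mD <-]].
rewrite /image_set_system/= setTI.
rewrite (_ : _ @^-1` _ = (@complex.Re R @^-1` C) `&` (@complex.Im R @^-1` D)).
  apply: multiplier_sets_setI; apply: multiplier_sets_preimage => //.
  - exact: multiplier_Re.
  - exact: circle_normr_Re.
  - exact: multiplier_Im.
  - exact: circle_normr_Im.
by apply/seteqP; split.
Qed.

(** The constant 1 lies in shift_kernel K, and \1_A is a multiplier; their product
    is therefore in K. *)
Lemma bounded_closed_indic A : (forall n : int, K (fun z => z ^ n)) ->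
  measurable A -> K (fun z => Complex (\1_A z) 0).
Proof.
move=> Kz /measurable_multiplier_sets[mA [_ _ /(_ (fun=> 1))]] /(_ _ 0).
rewrite (_ : (fun z : R[i] => _ * 1 * z ^ 0) = (fun z => Complex (\1_A z) 0)).
  by apply=> n; under eq_fun do rewrite mul1r; exact: Kz.
by apply/funext => z; rewrite expr0z !mulr1.
Qed.

End Indicators.

(** * Kernels of integral functionals are closed under bounded limits *)

Section Kernels.
Context (R : realType).
Implicit Types (f g u v : R[i] -> R[i]).
Local Notation mu := (@circle_measure R).
Local Notation circle := (@circle R).
Local Notation L2 := (@Lcircle R 2%:E).

Lemma L2_cintegrable f : L2 f -> cintegrable f.
Proof.
move=> fL; have := cintegrable_mul fL (L2_cst 1).
by congr cintegrable; apply/funext => z; rewrite conjC1 mulr1.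
Qed.

Lemma L2_bounded f (C : R) : measurable_fun setT f ->
  {ae mu, forall z, sqnormc (f z) <= C} -> L2 f.
Proof.
move=> mf fC; apply: (@L2_le _ _ (fun=> C)) => //.
exact: finite_measure_integrable_cst.
Qed.

Lemma Rintegral_bounded_cvg0 (F : nat -> R[i] -> R) (G : R[i] -> R) (C : R) :
  (forall n, mu.-integrable setT (fun z => (F n z)%:E)) ->
  measurable_fun setT G ->
  {ae mu, forall z n, `|F n z| <= C} ->
  {ae mu, forall z, F n z @[n --> \oo] --> G z} ->
  (forall n, \int[mu]_z F n z = 0) -> \int[mu]_z G z = 0.
Proof.
move=> iF mG FC FG F0.
have [||||| _ _] := @dominated_convergence _ _ _ mu setT measurableT
  (fun n z => (F n z)%:E) (EFin \o G) (EFin \o cst C).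
- by move=> n; exact: measurable_int (iF n).
- exact/measurable_EFinP.
- by apply: filterS FG => z Fz _; apply: cvg_EFin => //; exact: nearW.
- exact: finite_measure_integrable_cst.
- by apply: filterS FC => z Fz n _; rewrite /= lee_fin.
have E n : (\int[mu]_z (F n z)%:E = 0)%E.
  by rewrite -[LHS]fineK ?(F0 n)//; [congr EFin; exact: F0|exact: integrable_fin_num].
under eq_cvg do rewrite /= E.
move=> /(cvg_lim (@ereal_hausdorff R)) e.
by rewrite /Rintegral -[X in fine X]e lim_cst.
Qed.

Lemma cintegral_bounded_cvg0 (F : nat -> R[i] -> R[i]) (G : R[i] -> R[i]) (C : R) :
  (forall n, measurable_fun setT (F n)) -> measurable_fun setT G ->
  (forall n, {ae mu, forall z, sqnormc (F n z) <= C}) ->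
  ae_cvg_to F G -> (forall n, cintegral (F n) = 0) -> cintegral G = 0.
Proof.
move=> mF mG FC FG F0.
have /measurable_complexP[mr mi] := mG.
have cF n : cintegrable (F n) by apply/L2_cintegrable/L2_bounded; [exact: mF|exact: FC].
have {}FC : {ae mu, forall z n, sqnormc (F n z) <= C} by exact: ae_foralln.
have le1 (x : R) : `|x| <= 1 + x ^+ 2.
  have := sqr_ge0 (x - 1); have := sqr_ge0 (x + 1) => ? ?; rewrite ler_norml; apply/andP; split; lra.
apply: eqC => /=.
  apply: (@Rintegral_bounded_cvg0 (fun n z => Re (F n z)) _ (1 + C)) => //.
  - by move=> n; case: (cF n).
  - apply: filterS FC => z Fz n; apply: le_trans (le1 _) _.
    by rewrite lerD2l; exact: le_trans (sqr_Re_le _) (Fz n).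
  - by apply: filterS FG => z [].
  - by move=> n; have := F0 n => -[].
apply: (@Rintegral_bounded_cvg0 (fun n z => Im (F n z)) _ (1 + C)) => //.
- by move=> n; case: (cF n).
- apply: filterS FC => z Fz n; apply: le_trans (le1 _) _.
  by rewrite lerD2l; exact: le_trans (sqr_Im_le _) (Fz n).
- by apply: filterS FG => z [].
- by move=> n; have := F0 n => -[].
Qed.

Lemma sqnormcD_le (z w : R[i]) : sqnormc (z + w) <= 2 * (sqnormc z + sqnormc w).
Proof.
rewrite /sqnormc !ReImE.
by have := sqr_ge0 (Re z - Re w); have := sqr_ge0 (Im z - Im w); lra.
Qed.

Lemma ccvgD (x y : nat -> R[i]) (l k : R[i]) :
  Re (x n) @[n --> \oo] --> Re l /\ Im (x n) @[n --> \oo] --> Im l ->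
  Re (y n) @[n --> \oo] --> Re k /\ Im (y n) @[n --> \oo] --> Im k ->
  Re (x n + y n) @[n --> \oo] --> Re (l + k) /\
  Im (x n + y n) @[n --> \oo] --> Im (l + k).
Proof.
move=> [xr xi] [yr yi]; rewrite ReD ImD; split.
  by under eq_cvg do rewrite ReD; exact: cvgD.
by under eq_cvg do rewrite ImD; exact: cvgD.
Qed.

Lemma ccvgZ (a : R[i]) (x : nat -> R[i]) (l : R[i]) :
  Re (x n) @[n --> \oo] --> Re l /\ Im (x n) @[n --> \oo] --> Im l ->
  Re (a * x n) @[n --> \oo] --> Re (a * l) /\
  Im (a * x n) @[n --> \oo] --> Im (a * l).
Proof.
move=> [xr xi]; rewrite ReM ImM; split.
  by under eq_cvg do rewrite ReM; apply: cvgB; exact: cvgMr.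
by under eq_cvg do rewrite ImM; apply: cvgD; exact: cvgMr.
Qed.

Section TwoPointKernel.
Variables (eta theta sigma : R[i] -> R[i]) (M : R).
Hypotheses (meta : measurable_fun setT eta) (mtheta : measurable_fun setT theta)
  (msigma : measurable_fun setT sigma).
Hypothesis etaM : {ae mu, forall z, sqnormc (eta z) <= M}.
Hypothesis thetaM : {ae mu, forall z, sqnormc (theta z) <= M}.
Hypothesis sigma_circle : forall z, circle z -> circle (sigma z).

Let L u z := eta z * u z + theta z * u (sigma z).

Let mL u : measurable_fun setT u -> measurable_fun setT (L u).
Proof.
move=> mu'; apply: measurable_addc; apply: measurable_mulc => //.
exact: (measurableT_comp mu').
Qed.

Let L_bounded u (C : R) : (forall z, circle z -> sqnormc (u z) <= C) ->
  {ae mu, forall z, sqnormc (L u z) <= 2 * (M * C + M * C)}.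
Proof.
move=> uC; have := @ae_circle R.
apply: filterS3 etaM thetaM => z ez tz z1.
apply: le_trans (sqnormcD_le _ _) _; rewrite !sqnormcM ler_pM2l// lerD//.
  by apply: ler_pM; rewrite ?sqnormc_ge0//; exact: uC.
by apply: ler_pM; rewrite ?sqnormc_ge0//; exact/uC/sigma_circle.
Qed.

(** The case theta = 0 is the functional u |-> int eta u; the case eta = -1,
    theta = 1 compares arc length with its image under sigma.  Limits are
    handled by dominated convergence. *)
Lemma bounded_closed_kernel : bounded_closed
  [set u | [/\ measurable_fun setT u, circle_bounded u &
    cintegral (fun z => eta z * u z + theta z * u (sigma z)) = 0]].
Proof.
have cL u : measurable_fun setT u -> circle_bounded u -> cintegrable (L u).
  by move=> mu' [C /L_bounded uC]; apply/L2_cintegrable/L2_bounded; [exact: mL|exact: uC].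
split=> [u []//|u []//|a u v [mu' bu u0] [mv bv v0]|u v mv uv [mu' [C uC] u0]|
    u v C Ku mv uC uv].
- split.
  + by apply: measurable_addc => //; exact: measurable_mulc.
  + have [[C uC] [D vD]] := (bu, bv); exists (2 * (sqnormc a * C + D)) => z z1.
    apply: le_trans (sqnormcD_le _ _) _; rewrite sqnormcM ler_pM2l// lerD ?vD//.
    by rewrite ler_wpM2l ?sqnormc_ge0// uC.
  + have := cintegralD (cintegrableZ a (cL _ mu' bu)) (cL _ mv bv).
    rewrite cintegralZ; last exact: cL.
    rewrite /L u0 v0 mulr0 addr0 => <-; congr cintegral; apply/funext => z; ring.
- split=> //; first by exists C => z z1; rewrite -uv// uC.
  rewrite -u0; apply: ae_eq_cintegral; [exact: mL|exact: mL|].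
  by apply: ae_eq_circle => z z1; rewrite !uv//; exact: sigma_circle.
- have vC z : circle z -> sqnormc (v z) <= C.
    move=> z1; have [ur ui] := uv z z1.
    have usq : sqnormc (u n z) @[n --> \oo] --> sqnormc (v z).
      by apply: cvgD; [exact: (cvgM ur ur)|exact: (cvgM ui ui)].
    rewrite -(cvg_lim (@Rhausdorff R) usq); apply: limr_le.
      by apply/cvg_ex; exists (sqnormc (v z)).
    by apply: nearW => n; exact: uC.
  split=> //; first by exists C.
  apply: (@cintegral_bounded_cvg0 (fun n => L (u n)) _ (2 * (M * C + M * C))).
  + by move=> n; apply: mL; have [] := Ku n.
  + exact: mL.
  + by move=> n; apply: L_bounded; exact: uC.
  + apply: filterS (@ae_circle R) => z z1.
    have [ur ui] := uv z z1; have [sr si] := uv _ (sigma_circle z1).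
    by apply: ccvgD; apply: ccvgZ; split.
  + by move=> n; have [] := Ku n.
Qed.

End TwoPointKernel.
End Kernels.

(** * Uniqueness of Fourier coefficients and invariance under reflections *)

Section Uniqueness.
Context (R : realType).
Implicit Types (f g h : R[i] -> R[i]).
Local Notation mu := (@circle_measure R).
Local Notation circle := (@circle R).
Local Notation L2 := (@Lcircle R 2%:E).

(** The annihilator of eta contains all z^n, hence all indicator functions, and
    a function with zero integral over every measurable set is null. *)
Lemma fourier_uniqueness (eta : R[i] -> R[i]) (M : R) : measurable_fun setT eta ->
  {ae mu, forall z, sqnormc (eta z) <= M} ->
  (forall n : int, cintegral (fun z => eta z * z ^ n) = 0) ->
  {ae mu, forall z, eta z = 0}.
Proof.
move=> meta etaM eta0.
have M0 : {ae mu, forall z, sqnormc (0 : R[i]) <= M}.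
  by apply: filterS etaM => z; apply: le_trans; rewrite /sqnormc/= expr0n addr0 sqnormc_ge0.
have idc : forall z : R[i], circle z -> circle (id z) by [].
have HK := bounded_closed_kernel meta (@measurable_cst _ _ _ _ setT (0 : R[i]))
  (@measurable_id _ _ setT) etaM M0 idc.
have zE u : (fun z : R[i] => eta z * u z + cst 0 z * u (id z)) = (fun z => eta z * u z).
  by apply/funext => z; rewrite mul0r addr0.
have etaA (A : set R[i]) : measurable A -> cintegral (fun z => eta z * Complex (\1_A z) 0) = 0.
  move=> /(bounded_closed_indic HK) [n|_ _]; last by rewrite zE.
  split; [exact: measurable_exprz| |by rewrite zE].
  by exists 1 => z z1; rewrite (circle_exprz n z1).
have [ir ii] := L2_cintegrable (L2_bounded meta etaM).
have zero (F : R[i] -> R) : mu.-integrable setT (EFin \o F) ->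
    (forall A, measurable A -> \int[mu]_z (F z * \1_A z) = 0) ->
    {ae mu, forall z, F z = 0}.
  move=> iF FA.
  have FA0 A : measurable A -> Rintegral mu A F = 0.
    move=> mA; rewrite Rintegral_mkcond -[RHS](FA A mA).
    apply: eq_Rintegral => z _; rewrite patchE indicE.
    by case: ifP; rewrite ?mulr1 ?mulr0.
  have : ae_eq mu setT (EFin \o F) (cst 0%E).
    apply: integral_ae_eq => // A _ mA; rewrite integral0 -[LHS]fineK.
      by congr EFin; exact: FA0.
    apply: integrable_fin_num => //.
    exact: (integrableS measurableT mA (@subsetT _ A) iF).
  by apply: filterS => z /(_ Logic.I) [].
have r0 : {ae mu, forall z, Re (eta z) = 0}.
  apply: zero => // A mA; have /(congr1 (@complex.Re R)) /= e := etaA A mA; rewrite -[RHS]e.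
  by apply: eq_Rintegral => z _; rewrite ReM/= mulr0 subr0.
have i0 : {ae mu, forall z, Im (eta z) = 0}.
  apply: zero => // A mA; have /(congr1 (@complex.Im R)) /= e := etaA A mA; rewrite -[RHS]e.
  by apply: eq_Rintegral => z _; rewrite ImM/= mulr0 add0r.
by apply: filterS2 r0 i0 => z zr zi; apply: eqC.
Qed.

Section Reflection.
Variable lambda : R[i].
Hypothesis lambda1 : circle lambda.

Definition reflect_circle (z : R[i]) := lambda * z^*.

Lemma measurable_reflect : measurable_fun setT reflect_circle.
Proof.
apply: measurable_mulc; first exact: measurable_cst.
by apply: measurable_conjc; exact: measurable_id.
Qed.

Lemma circle_reflect z : circle z -> circle (reflect_circle z).
Proof. by move=> z1; rewrite /circle/= sqnormcM sqnormc_conj lambda1 z1 mulr1. Qed.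

Lemma reflectK z : reflect_circle (reflect_circle z) = z.
Proof.
have := lambda1; rewrite /circle/= /sqnormc => l1.
apply: eqC; rewrite !ReImE.
  transitivity ((Re lambda ^+ 2 + Im lambda ^+ 2) * Re z); [by ring|by rewrite l1 mul1r].
transitivity ((Re lambda ^+ 2 + Im lambda ^+ 2) * Im z); [by ring|by rewrite l1 mul1r].
Qed.

Lemma measurable_preimage_reflect A : measurable A -> measurable (reflect_circle @^-1` A).
Proof. by move=> mA; rewrite -[X in measurable X]setTI; exact: measurable_reflect. Qed.

(** Arc length and its image have the same moments, since the n-th power of
    lambda * conj z is lambda^n z^-n on the circle. *)
Lemma circle_measure_reflect A : measurable A -> mu (reflect_circle @^-1` A) = mu A.
Proof.
move=> mA.
have b1 : {ae mu, forall z, sqnormc (-1 : R[i]) <= 1}.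
  by apply: aeW => z; rewrite /sqnormc !ReImE; lra.
have b2 : {ae mu, forall z, sqnormc (1 : R[i]) <= 1}.
  by apply: aeW => z; rewrite /sqnormc !ReImE; lra.
have HK := bounded_closed_kernel (@measurable_cst _ _ _ _ setT (-1 : R[i]))
  (@measurable_cst _ _ _ _ setT (1 : R[i])) measurable_reflect b1 b2 circle_reflect.
have [n|_ _ e0] := bounded_closed_indic HK _ mA.
  split; [exact: measurable_exprz|by exists 1 => z z1; rewrite (circle_exprz n z1)|].
  have cz k := @cintegrable_exprz R k.
  rewrite (@ae_eq_cintegral _ _ (fun z => (-1) * z ^ n + lambda ^ n * z ^ (- n))).
  - rewrite cintegralD; [|exact: cintegrableZ..].
    rewrite !cintegralZ//; have [->|n0] := eqVneq n 0.
      by rewrite oppr0 expr0z mul1r mulN1r addNr.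
    by rewrite !moment_circle ?oppr_eq0// !mulr0 addr0.
  - apply: measurable_addc; apply: measurable_mulc; try exact: measurable_cst.
      exact: measurable_exprz.
    exact: (measurableT_comp (measurable_exprz n) measurable_reflect).
  - by apply: measurable_addc; apply: measurable_mulc; try exact: measurable_cst; exact: measurable_exprz.
  - apply: ae_eq_circle => z z1; rewrite /= mul1r /reflect_circle -circle_conj_exprz//.
    rewrite exprzMl ?unitfE ?conjC_eq0 ?circle_neq0//; congr (_ + _ * _).
    by rewrite -circle_inv// circle_conj_exprz// exprz_inv.
have i1 B : measurable B -> mu.-integrable setT (EFin \o (\1_B : R[i] -> R)).
  by move=> mB; exact: integrable_indic.
have mA' := measurable_preimage_reflect mA.
have : \int[mu]_z (\1_(reflect_circle @^-1` A) z - \1_A z) = 0 :> R.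
  rewrite -[RHS](congr1 (@complex.Re R) e0); apply: eq_Rintegral => z _.
  by rewrite !ReImE/= !indicE; ring.
rewrite RintegralB//; [|exact: i1..].
rewrite /Rintegral !integral_indic// !setIT => /eqP; rewrite subr_eq0 => /eqP e.
have fin B : measurable B -> mu B \is a fin_num by exact: fin_num_measure.
by rewrite -[LHS]fineK ?fin// -[RHS]fineK ?fin// e.
Qed.

Lemma ae_reflect (P : R[i] -> Prop) : {ae mu, forall z, P z} ->
  {ae mu, forall z, P (reflect_circle z)}.
Proof.
move=> [N [mN N0 PN]]; exists (reflect_circle @^-1` N); split.
- exact: measurable_preimage_reflect.
- by rewrite circle_measure_reflect.
- by move=> z Pz; apply: PN.
Qed.

Lemma ge0_integral_reflect (F : R[i] -> \bar R) : measurable_fun setT F ->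
  (forall z, (0 <= F z)%E) ->
  (\int[mu]_z F (reflect_circle z) = \int[mu]_z F z)%E.
Proof.
move=> mF F0; have := @ge0_integral_pushforward _ _ _ _ _ _ measurable_reflect mu
  setT F measurableT mF (fun z _ => F0 z).
rewrite preimage_setT => <-.
apply: eq_measure_integral; first exact: measurable_reflect.
by move=> mr A mA _; exact: circle_measure_reflect.
Qed.

Lemma integral_reflect (F : R[i] -> \bar R) : measurable_fun setT F ->
  mu.-integrable setT (fun z => F (reflect_circle z)) ->
  (\int[mu]_z F (reflect_circle z) = \int[mu]_z F z)%E.
Proof.
move=> mF iF; have := @integral_pushforward _ _ _ _ _ _ measurable_reflect mu setT F mF.
rewrite preimage_setT => /(_ iF measurableT) <-.
apply: eq_measure_integral; first exact: measurable_reflect.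
by move=> mr A mA _; exact: circle_measure_reflect.
Qed.

Lemma L2_reflect f : L2 f -> L2 (fun z => f (reflect_circle z)).
Proof.
move=> /L2P[mf /integrableP[ms fi]]; apply/L2P; split.
  exact: (measurableT_comp mf measurable_reflect).
apply/integrableP; split.
  exact: (measurableT_comp ms measurable_reflect).
rewrite (ge0_integral_reflect (F := fun z => `|(sqnormc (f z))%:E|%E))//.
exact: measurableT_comp.
Qed.

Lemma cintegral_reflect f : measurable_fun setT f ->
  cintegrable (fun z => f (reflect_circle z)) ->
  cintegral (fun z => f (reflect_circle z)) = cintegral f.
Proof.
move=> /measurable_complexP[fr fi] [ir ii].
apply: eqC => /=; congr fine.
  by apply: (integral_reflect (F := fun z => (Re (f z))%:E)) => //; exact/measurable_EFinP.
by apply: (integral_reflect (F := fun z => (Im (f z))%:E)) => //; exact/measurable_EFinP.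
Qed.

Lemma inner_reflect f g : L2 f -> L2 g ->
  inner (fun z => f (reflect_circle z)) (fun z => g (reflect_circle z)) = inner f g.
Proof.
move=> fL gL; apply: (cintegral_reflect (f := fun z => f z * (g z)^*)).
  by apply: measurable_mulc; [case: fL|apply: measurable_conjc; case: gL].
by apply: (@cintegrable_mul _ (fun z => f (reflect_circle z)) (fun z => g (reflect_circle z)));
  exact: L2_reflect.
Qed.

End Reflection.
End Uniqueness.

(** * Toeplitz operators *)

Section Toeplitz.
Context (R : realType).
Implicit Types (f g h : R[i] -> R[i]).
Local Notation mu := (@circle_measure R).
Local Notation circle := (@circle R).
Local Notation L2 := (@Lcircle R 2%:E).
Local Notation H2 := (@Hardy2 R).

Lemma cnorm2_sqrt f : L2 f -> cnorm 2%:E f = (Num.sqrt (sqnorm f))%:E.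
Proof.
move=> fL; have := cnorm2E f; rewrite -sqnormEFin//.
have : (cnorm 2%:E f < +oo)%E by case: fL.
have : (0 <= cnorm 2%:E f)%E by exact: Lnorm_ge0.
case: (cnorm 2%:E f) => [r| |]//; rewrite lee_fin => r0 _ [].
by rewrite powR_mulrn// => <-; rewrite sqrtr_sqr ger0_norm.
Qed.

Lemma Linfty_bounded f : Lcircle +oo%E f ->
  exists M : R, 0 <= M /\ {ae mu, forall z, sqnormc (f z) <= M}.
Proof.
move=> [mf]; rewrite /cnorm unlock.
rewrite (_ : (0 < mu setT)%E = true); last by rewrite probability_setT lte01.
set F := fun z => _; move=> /= fy.
have := ess_sup_ge mu (abse \o (fun z => (Normc.normc (f z))%:E)).
move: fy; case: (ess_sup _ _) => [r _ fr| //|_ fr].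
  exists (r ^+ 2); split; first exact: sqr_ge0.
  apply: filterS fr => z; rewrite /= lee_fin sqnormcE => zr.
  rewrite -real_normK ?num_real// lerXn2r ?nnegrE//.
  exact: le_trans (normr_ge0 _) zr.
by exists 0; split=> //; apply: filterS fr.
Qed.

Section Symbol.
Variables (phi : R[i] -> R[i]) (M : R).
Hypotheses (mphi : measurable_fun setT phi) (M0 : 0 <= M).
Hypothesis phiM : {ae mu, forall z, sqnormc (phi z) <= M}.

Lemma L2_symbol f : L2 f -> L2 (fun z => phi z * f z).
Proof. exact: L2_bounded_mul phiM. Qed.

Lemma sqnorm_symbol_le f : L2 f -> sqnorm (fun z => phi z * f z) <= M * sqnorm f.
Proof.
move=> fL; have [mf _] := fL; have fi := L2_integrable fL.
rewrite -lee_fin EFinM !sqnormEFin//; last exact: L2_symbol.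
rewrite -integralZl//; apply: ae_ge0_le_integral => //.
- by move=> z _; rewrite lee_fin sqnormc_ge0.
- exact/measurable_EFinP/measurable_sqnormc/measurable_mulc.
- by move=> z _; rewrite -EFinM lee_fin mulr_ge0 ?sqnormc_ge0.
- by apply: measurable_funeM; exact/measurable_EFinP/measurable_sqnormc.
by apply: filterS phiM => z zM _; rewrite -EFinM lee_fin sqnormcM ler_wpM2r ?sqnormc_ge0.
Qed.

Lemma Hardy2_toeplitz f : H2 f -> H2 (toeplitz phi f).
Proof. by move=> fH; apply/Hardy2_proj/L2_symbol/Hardy2_L2. Qed.

Lemma inner_toeplitz f g : H2 f -> H2 g ->
  inner (toeplitz phi f) g = inner (fun z => phi z * f z) g.
Proof. by move=> fH gH; apply: inner_proj => //; apply/L2_symbol/Hardy2_L2. Qed.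

Lemma bounded_toeplitz : bounded_operator (toeplitz phi).
Proof.
split=> [f|a f g fH gH|]; first exact: Hardy2_toeplitz.
- have [fL gL] := (Hardy2_L2 fH, Hardy2_L2 gH).
  have [Tf Tg] := (Hardy2_toeplitz fH, Hardy2_toeplitz gH).
  have afgH := Hardy2_ZD a fH gH.
  have [Pf Pg] := (L2_symbol fL, L2_symbol gL).
  have := @inner_Hardy2_ae_eq _ _ (fun z => a * toeplitz phi f z + toeplitz phi g z)
    (Hardy2_toeplitz afgH) (Hardy2_ZD a Tf Tg).
  move=> H; apply: filterS (H _) => [z ->//|h hH]; have hL := Hardy2_L2 hH.
  rewrite inner_toeplitz// innerDl//; [|exact/L2Z/Hardy2_L2|exact: Hardy2_L2].
  rewrite innerZl//; last exact: Hardy2_L2.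
  rewrite !inner_toeplitz// -innerZl// -innerDl//; last exact: L2Z.
  by congr inner; apply/funext => z; ring.
exists (Num.sqrt M) => f fH; have fL := Hardy2_L2 fH.
rewrite !cnorm2_sqrt//; last exact/Hardy2_L2/Hardy2_toeplitz.
rewrite -EFinM lee_fin -sqrtrM// ler_wsqrtr//.
exact: le_trans (sqnorm_proj_le (L2_symbol fL)) (sqnorm_symbol_le fL).
Qed.

End Symbol.

Lemma adjointP (T S : (R[i] -> R[i]) -> R[i] -> R[i]) g : H2 (S g) ->
  (forall f, H2 f -> inner (T f) g = inner f (S g)) ->
  H2 (adjoint T g) /\ forall f, H2 f -> inner (T f) g = inner f (adjoint T g).
Proof.
move=> Sg TS.
exact: (@xgetPex _ _ [set h | H2 h /\ forall f, H2 f -> inner (T f) g = inner f h]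
  (ex_intro _ (S g) (conj Sg TS))).
Qed.

End Toeplitz.

(** * The conjugation and the symmetry criterion *)

Section Conjugation.
Context (R : realType).
Implicit Types (f g h : R[i] -> R[i]).
Local Notation mu := (@circle_measure R).
Local Notation circle := (@circle R).
Local Notation L2 := (@Lcircle R 2%:E).
Local Notation H2 := (@Hardy2 R).

Lemma L2_conj f : L2 f -> L2 (fun z => (f z)^*).
Proof.
move=> fL; have [mf _] := fL; apply: (@L2_le _ _ (fun z => sqnormc (f z))).
- exact: measurable_conjc.
- exact: L2_integrable.
- by apply: aeW => z; rewrite sqnormc_conj.
Qed.

Variable lambda : R[i].
Hypothesis lambda1 : circle lambda.
Local Notation C := (C1 lambda).

Lemma L2_C1 f : L2 f -> L2 (C f).
Proof. by move=> /(L2_reflect lambda1)/L2_conj. Qed.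

Lemma C1K f : C (C f) = f.
Proof. by apply/funext => z; rewrite /C1 conjCK; congr f; exact: (reflectK lambda1). Qed.

Lemma inner_C1 f g : L2 f -> L2 g -> inner (C f) (C g) = inner g f.
Proof.
move=> fL gL; rewrite -(inner_reflect lambda1 gL fL).
by congr cintegral; apply/funext => z; rewrite /C1 conjCK mulrC.
Qed.

(** C maps z^n to a unimodular multiple of itself. *)
Lemma Hardy2_C1 f : H2 f -> H2 (C f).
Proof.
move=> [fL f0]; split; first exact: L2_C1.
move=> n n0; have eL := @L2_exprz R n.
have -> : fourier_coef (C f) n =
    inner (C f) (fun z => lambda ^ n * C (fun w => w ^ n) z).
  apply: ae_eq_innerr; [exact: eL|exact/L2Z/L2_C1|exact: L2_C1|].
  apply: ae_eq_circle => z z1; rewrite /C1.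
  rewrite circle_conj_exprz; last exact: (circle_reflect lambda1).
  rewrite exprzMl ?unitfE ?conjC_eq0 ?circle_neq0// mulrA -expfzDr ?circle_neq0//.
  by rewrite subrr expr0z mul1r -circle_inv// exprz_inv opprK.
rewrite innerZr; [|exact: L2_C1..]; rewrite inner_C1//.
by rewrite innerC// -[inner f _]/(fourier_coef f n) f0// conjC0 mulr0.
Qed.

Lemma conjugation_C1 : conjugation C.
Proof.
split=> [f|a f g _ _|f _|f g fH gH]; first exact: Hardy2_C1.
- by apply: aeW => z _; rewrite /C1 rmorphD rmorphM.
- by rewrite C1K; exact: aeW.
- by apply: inner_C1; exact: Hardy2_L2.
Qed.

Variables (phi : R[i] -> R[i]) (M : R).
Hypotheses (mphi : measurable_fun setT phi) (M0 : 0 <= M).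
Hypothesis phiM : {ae mu, forall z, sqnormc (phi z) <= M}.

Let psi z := phi (reflect_circle lambda z).

Let mpsi : measurable_fun setT psi.
Proof. exact: (measurableT_comp mphi (measurable_reflect lambda)). Qed.

Let psiM : {ae mu, forall z, sqnormc (psi z) <= M}.
Proof. exact: (ae_reflect lambda1 phiM). Qed.

(** The adjoint is compression of multiplication by conj phi. *)
Lemma toeplitz_adjointP g : H2 g -> H2 (adjoint (toeplitz phi) g) /\
  forall f, H2 f -> inner (toeplitz phi f) g = inner f (adjoint (toeplitz phi) g).
Proof.
move=> gH; have gL := Hardy2_L2 gH.
have pgL : L2 (fun z => (phi z)^* * g z).
  apply: (@L2_symbol _ _ M) => //; first exact: measurable_conjc.
  by apply: filterS phiM => z; rewrite sqnormc_conj.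
apply: (@adjointP _ _ (fun g => proj_Hardy2 (fun z => (phi z)^* * g z))).
  exact: Hardy2_proj.
move=> f fH; have fL := Hardy2_L2 fH; rewrite (inner_toeplitz mphi phiM)//.
rewrite [RHS]innerC//; last exact/Hardy2_L2/Hardy2_proj.
rewrite inner_proj// -innerC//.
by congr cintegral; apply/funext => z; rewrite rmorphM/= conjCK mulrCA mulrA.
Qed.

(** <C T^* C f, g> = <C g, T^* C f> = <T C g, C f> = <phi (C g), C f>, and the
    change of variables z |-> lambda * conj z finishes. *)
Lemma inner_C1_adjoint_C1 f g : H2 f -> H2 g ->
  inner (C (adjoint (toeplitz phi) (C f))) g = inner (fun z => psi z * f z) g.
Proof.
move=> fH gH; have [fL gL] := (Hardy2_L2 fH, Hardy2_L2 gH).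
have [CfH CgH] := (Hardy2_C1 fH, Hardy2_C1 gH).
have [AH AP] := toeplitz_adjointP CfH.
rewrite -{1}(C1K g) inner_C1; [|exact: Hardy2_L2..].
rewrite -AP// (inner_toeplitz mphi phiM)//.
have pfL : L2 (fun z => psi z * f z) by exact: (L2_symbol mpsi psiM).
rewrite -(inner_reflect lambda1 pfL gL); congr cintegral; apply/funext => z.
by rewrite /psi (reflectK lambda1) /C1 conjCK mulrAC.
Qed.

Lemma toeplitz_C1_symmetric_inner :
  complex_symmetric (toeplitz phi) C <->
  forall f g, H2 f -> H2 g ->
    inner (fun z => phi z * f z) g = inner (fun z => psi z * f z) g.
Proof.
split=> [[_ _ TC] f g fH gH|phipsi].
  have CAH : H2 (C (adjoint (toeplitz phi) (C f))).
    by apply/Hardy2_C1; case: (toeplitz_adjointP (Hardy2_C1 fH)).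
  rewrite -inner_C1_adjoint_C1// -(inner_toeplitz mphi phiM)//.
  apply: ae_eq_innerl; [exact/Hardy2_L2/(Hardy2_toeplitz mphi phiM)|exact: Hardy2_L2|exact: Hardy2_L2|].
  by apply: filterS (TC f fH) => z; apply.
split; [exact: (bounded_toeplitz mphi M0 phiM)|exact: conjugation_C1|].
move=> f fH; have CAH : H2 (C (adjoint (toeplitz phi) (C f))).
  by apply/Hardy2_C1; case: (toeplitz_adjointP (Hardy2_C1 fH)).
have := inner_Hardy2_ae_eq (Hardy2_toeplitz mphi phiM fH) CAH.
move=> H; apply: filterS (H _) => [z -> //|g gH].
by rewrite inner_C1_adjoint_C1// (inner_toeplitz mphi phiM)// phipsi.
Qed.

(** Testing on f = z^a, g = z^b with a, b >= 0 reaches all the exponents a - b. *)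
Lemma inner_symbols_eq_ae :
  (forall f g, H2 f -> H2 g ->
    inner (fun z => phi z * f z) g = inner (fun z => psi z * f z) g) <->
  {ae mu, forall z, phi z = psi z}.
Proof.
split=> [phipsi|phipsi f g fH gH]; last first.
  have [fL gL] := (Hardy2_L2 fH, Hardy2_L2 gH).
  apply: ae_eq_innerl => //; [exact: (L2_symbol mphi phiM)|exact: (L2_symbol mpsi psiM)|].
  by apply: filterS phipsi => z ->.
pose eta z := phi z - psi z.
have meta : measurable_fun setT eta by apply: measurable_addc => //; exact: measurable_oppc.
have etaM : {ae mu, forall z, sqnormc (eta z) <= 2 * (M + M)}.
  apply: filterS2 phiM psiM => z pM qM; apply: le_trans (sqnormcD_le _ _) _.
  by rewrite ler_pM2l// lerD// -mulN1r sqnormcM (_ : sqnormc (-1) = 1) ?mul1r// /sqnormc !ReImE; ring.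
have moment (a b : nat) : cintegral (fun z => eta z * z ^ (a%:Z - b%:Z)) = 0.
  have [aH bH] := (Hardy2_exprn R a, Hardy2_exprn R b).
  have [aL bL] := (Hardy2_L2 aH, Hardy2_L2 bH).
  have pL := L2_symbol mphi phiM aL; have qL := L2_symbol mpsi psiM aL.
  have : inner ((fun z => phi z * z ^ a) \- (fun z => psi z * z ^ a)) (fun z => z ^ b) = 0.
    by rewrite innerBl// phipsi// subrr.
  move=> <-; apply: ae_eq_cintegral.
  - by apply: measurable_mulc => //; exact: measurable_exprz.
  - apply: measurable_mulc; first by case: (L2B pL qL).
    by apply: measurable_conjc; exact: measurable_exprz.
  - apply: ae_eq_circle => z z1; rewrite /= circle_conj_exprz// expfzDr ?circle_neq0//.
    by rewrite /eta; ring.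
have : {ae mu, forall z, eta z = 0}.
  apply: (fourier_uniqueness meta etaM) => -[] n.
    by have := moment n 0%N; rewrite subr0.
  by have := moment 0%N n.+1; rewrite sub0r NegzE.
by apply: filterS => z /eqP; rewrite subr_eq0 => /eqP.
Qed.

End Conjugation.

Theorem theorem2p3 (R : realType) (phi : R[i] -> R[i]) (lambda : R[i])
    (phi_Loo : Lcircle +oo%E phi) (lambda1 : `|lambda| = 1) :
  complex_symmetric (toeplitz phi) (C1 lambda) <->
  {ae @circle_measure R, forall z, phi z = phi (lambda * z^*)}.
Proof.
have [M [M0 phiM]] := Linfty_bounded phi_Loo.
have mphi := phi_Loo.1.
have lambda_circle := sqnormc_eq1 lambda1.
exact: (iff_trans (toeplitz_C1_symmetric_inner lambda_circle mphi M0 phiM)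
                  (inner_symbols_eq_ae lambda_circle mphi phiM)).
Qed.
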